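(* Let $p$ be a non-degenerate super-critical offspring distribution with finite mean, and let $\tau$ be the Galton–Watson tree with offspring distribution $p$. For $\varepsilon\in(0,1)$, let $\tau_{(\varepsilon)}$ be distributed as $\tau$ conditionally on $\{0<W\le\varepsilon\}$. Then $\tau_{(\varepsilon)}$ converges locally in distribution to $\tau^0$ as $\varepsilon\to0$.
   Context: $\mathbb N=\{0,1,2,\dots\}$, $\mathbb N^*=\{1,2,\dots\}$. Trees. Let $\mathcal U=\bigcup_{n\ge0}(\mathbb N^* )^n$ with $(\mathbb N^* )^0=\{\partial\}$; $|u|=n$ if $u\in(\mathbb N^* )^n$. A tree $\mathbf t$ is a subset of $\mathcal U$ containing the root $\partial$, closed under taking prefixes, such that for every $u\in\mathbf t$ there is $k_u(\mathbf t)\in\mathbb N\cup\{\infty\}$ (number of children) with, for $i\in\mathbb N^*$, $ui\in\mathbf t\iff 1\le i\le k_u(\mathbf t)$. Set $k_u(\mathbf t)=-1$ if $u\notin\mathbf t$, and $z_n(\mathbf t)=\#\{u\in\mathbf t:|u|=n\}$. Local convergence in distribution of random trees $T_n$ to $T$ means convergence in distribution of $(k_u(T_n))_{u\in\mathcal U}$ to $(k_u(T))_{u\in\mathcal U}$ for finite-dimensional marginals. $p=(p(k),k\in\mathbb N)$ has generating function $f$ and mean $\mu=f'(1)$; super-critical means $\mu>1$. $\mathfrak a$ and $\mathfrak b\in\mathbb N\cup\{\infty\}$ are the infimum and supremum of the support of $p$; non-degenerate means $\mathfrak a<\mathfrak b$. $Z_n=z_n(\tau)$. $\mathfrak c\in[0,1)$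 is the extinction probability, the root in $[0,1)$ of $f(s)=s$; $\mathfrak c=0$ iff $\mathfrak a\ge1$. Seneta–Heyde norming: $c_0\in(-1/\log\mathfrak c,\infty)$ ($c_0>0$ if $\mathfrak c=0$) and $(c_n)$ positive with $f(e^{-1/c_{n+1}})=e^{-1/c_n}$. $W\geq 0$ is the a.s. limit of $Z_n/c_n$; its law is $\mathfrak c\,\delta_0(dt)+w(t)\mathbf 1_{\{t>0\}}dt$ with $w$ positive continuous on $(0,\infty)$. $\tau^0$: if $\mathfrak c=0$, the deterministic regular $\mathfrak a$-ary tree (every vertex has $\mathfrak a$ children). If $\mathfrak c>0$, the Kesten tree: let $\mathfrak p(n)=\mathfrak c^{n-1}p(n)$ and $\mathfrak p_{[1]}(n)=n\,\mathfrak p(n)/f'(\mathfrak c)$; $\tau^0$ is the tree, types being forgotten, of a two-type Galton–Watson tree with types s, e, whose root has type s; a type e vertex has only type e children, their number having law $\mathfrak p$; a type s vertex has a number of children of law $\mathfrak p_{[1]}$, all of type e except one, chosen uniformly, of type s. *)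

(* Defs.v *)
From HB Require Import structures.
From mathcomp Require Import all_boot all_order all_algebra.
From mathcomp Require Import all_classical all_reals all_analysis.
Import Order.TTheory GRing.Theory Num.Theory.
Import numFieldNormedType.Exports.

Set Implicit Arguments.
Unset Strict Implicit.
Unset Printing Implicit Defensive.

Local Open Scope classical_set_scope.
Local Open Scope ring_scope.

(* Vertices are words in the letters 1, 2, 3, ...; the root is [::] and the
   i-th child of u is [rcons u i].  The letter 0 is never used. *)
Definition ulam : set (seq nat) := [set u | 0%N \notin u].

(* [None] stands for an infinite number of children. *)
Definition is_tree (t : set (seq nat)) : Prop :=
  [/\ t `<=` ulam,
      t [::],
      forall u v, t (u ++ v) -> t u
    & forall u, t u -> exists k : option nat, forall i, (0 < i)%N ->
        t (rcons u i) <-> (if k is Some m then (i <= m)%N else true) ].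

Definition num_children (R : realType) (t : set (seq nat)) (u : seq nat) : \bar R :=
  if `[< t u >] then @counting _ R [set i | t (rcons u i)] else (-1)%:E.

Definition gen_size (R : realType) (t : set (seq nat)) (n : nat) : \bar R :=
  @counting _ R [set u | t u /\ size u = n].

Definition subtree (t : set (seq nat)) (i : nat) : set (seq nat) :=
  [set v | t (i :: v)].

Definition tree_cylinders : set (set (set (seq nat))) :=
  [set [set t : set (seq nat) | t u] | u in [set: seq nat]].

Definition tree_space := g_sigma_algebraType tree_cylinders.

Definition random_tree d (Om : measurableType d) (T : Om -> tree_space) : Prop :=
  measurable_fun [set: Om] T /\ forall o, is_tree (T o).

Definition is_pmf (R : realType) (p : nat -> R) : Prop :=
  (forall k, 0 <= p k) /\ (\sum_(0 <= k <oo) (p k)%:E = 1)%E.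

Definition mean (R : realType) (p : nat -> R) : \bar R :=
  (\sum_(0 <= k <oo) (k%:R * p k)%:E)%E.

Definition genfun (R : realType) (p : nat -> R) (s : R) : R :=
  limn (series (fun k => p k * s ^+ k)).

Definition support_inf (R : realType) (p : nat -> R) : \bar R :=
  ereal_inf [set k%:R%:E | k in [set k : nat | 0 < p k]].

Definition support_sup (R : realType) (p : nat -> R) : \bar R :=
  ereal_sup [set k%:R%:E | k in [set k : nat | 0 < p k]].

Definition is_extinction_prob (R : realType) (p : nat -> R) (c : R) : Prop :=
  [/\ 0 <= c, c < 1 & genfun p c = c].

(* The branching property: the root has k children with probability p k and,
   given this, the k subtrees above the root are independent copies of T. *)
Definition is_GW (R : realType) (p : nat -> R) d (Om : measurableType d)
    (P : probability Om R) (T : Om -> tree_space) : Prop :=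
  random_tree T /\
  forall (k : nat) (A : nat -> set tree_space), (forall i, measurable (A i)) ->
    P [set o | num_children R (T o) [::] = k%:R%:E /\
               forall i, (1 <= i <= k)%N -> A i (subtree (T o) i)]
    = ((p k)%:E * \prod_(1 <= i < k.+1) P (T @^-1` A i))%E.

(* [c] is the extinction probability of [p].  When c = 0 the only constraint on
   r 0 is positivity. *)
Definition seneta_heyde (R : realType) (p : nat -> R) (c : R) (r : nat -> R) : Prop :=
  [/\ 0 < c -> - 1 / ln c < r 0%N,
      forall n, 0 < r n
    & forall n, genfun p (expR (- 1 / r n.+1)) = expR (- 1 / r n)].

Definition is_norming_limit (R : realType) (r : nat -> R) d (Om : measurableType d)
    (P : probability Om R) (T : Om -> tree_space) (W : Om -> R) : Prop :=
  [/\ measurable_fun [set: Om] W, forall o, 0 <= W o &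
      {ae P, forall o,
         (gen_size R (T o) n * ((r n)^-1)%:E)%E @[n --> \oo] --> (W o)%:E}].

Definition distributed_conditionally (R : realType)
    d (Om : measurableType d) (P : probability Om R) (T : Om -> tree_space)
    (E : set Om)
    d' (Om' : measurableType d') (P' : probability Om' R) (T' : Om' -> tree_space)
    : Prop :=
  forall A : set tree_space, measurable A ->
    P' (T' @^-1` A) = (P (T @^-1` A `&` E) * ((fine (P E))^-1)%:E)%E.

(* A typed tree sends a vertex to [Some] of its type, and a word which is not a
   vertex to [None]. *)
Definition typed_cylinders (X : choiceType) : set (set (seq nat -> option X)) :=
  [set [set t : seq nat -> option X | t ux.1 = ux.2]
    | ux in [set: seq nat * option X]].

Definition typed_tree_space (X : choiceType) := g_sigma_algebraType (@typed_cylinders X).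

Definition forget_types (X : choiceType) (t : seq nat -> option X) : set (seq nat) :=
  [set u | t u <> None].

Definition typed_subtree (X : choiceType) (t : seq nat -> option X) (i : nat) :
  seq nat -> option X := fun v => t (i :: v).

(* [zeta x w] is the probability that a vertex of type x has [size w] children
   with successive types given by w; [Q x] is the law of the tree whose root has
   type x. *)
Definition is_multitype_GW (R : realType) (X : choiceType) (zeta : X -> seq X -> R)
    (Q : X -> probability (typed_tree_space X) R) : Prop :=
  forall x : X,
    {ae Q x, forall t, is_tree (forget_types t)} /\
    forall (w : seq X) (A : nat -> set (typed_tree_space X)),
      (forall i, measurable (A i)) ->
      Q x [set t : typed_tree_space X |
             [/\ t [::] = Some x,
                 forall i, t [:: i.+1] = onth w i
               & forall i, (i < size w)%N -> A i (typed_subtree t i.+1)]]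
      = ((zeta x w)%:E * \prod_(i < size w) Q (nth x w i) (A i))%E.

Definition kesten_p (R : realType) (p : nat -> R) (c : R) (n : nat) : R :=
  c ^ (n%:Z - 1) * p n.

Definition kesten_p1 (R : realType) (p : nat -> R) (c : R) (n : nat) : R :=
  n%:R * kesten_p p c n / derive1 (genfun p) c.

(* The type s is [true], the type e is [false].  Each of the n words of length
   n with exactly one letter s gets 1/n of the mass that the size-biased law
   gives to n, i.e. the position of the child of type s is uniform. *)
Definition kesten_offspring (R : realType) (p : nat -> R) (c : R)
    (x : bool) (w : seq bool) : R :=
  if x then (if count_mem true w == 1%N
             then kesten_p1 p c (size w) / (size w)%:R else 0)
  else (if count_mem true w == 0%N then kesten_p p c (size w) else 0).

Definition regular_tree (R : realType) (a : \bar R) : set (seq nat) :=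
  [set u | forall i, i \in u -> (1 <= i)%N /\ (i%:R%:E <= a)%E].

Definition is_tau0 (R : realType) (p : nat -> R) (c : R) d (Om : measurableType d)
    (P : probability Om R) (T : Om -> tree_space) : Prop :=
  [/\ random_tree T,
      c = 0 -> {ae P, forall o, T o = regular_tree (support_inf p)}
    & 0 < c -> exists Q : bool -> probability (typed_tree_space bool) R,
        is_multitype_GW (kesten_offspring p c) Q /\
        forall A : set tree_space, measurable A ->
          P (T @^-1` A) = Q true ((@forget_types bool) @^-1` A)].

(* The values of [num_children] lie in {-1, 0, 1, ..., oo}, whose topology as a
   subspace of \bar R is the usual one: every point but oo is isolated. *)
Definition local_cvg_distr (R : realType) (I : Type) (F : set_system I)
    d (Om : I -> measurableType d) (P : forall i, probability (Om i) R)
    (T : forall i, Om i -> tree_space)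
    d0 (Om0 : measurableType d0) (P0 : probability Om0 R) (T0 : Om0 -> tree_space)
    : Prop :=
  forall (m : nat) (u : 'I_m -> seq nat) (g : {ptws 'I_m -> \bar R} -> R),
    (forall j, ulam (u j)) -> continuous g -> bounded_fun g ->
    ('E_(P i)[fun o => g (fun j => num_children R (T i o) (u j))])%E @[i --> F]
      --> ('E_P0[fun o => g (fun j => num_children R (T0 o) (u j))])%E.

(* Main.v *)
Require Import Defs.
From HB Require Import structures.
From mathcomp Require Import all_boot all_order all_algebra.
From mathcomp Require Import all_classical all_reals all_analysis.
From mathcomp Require Import measurable_realfun lra.
Import Order.TTheory GRing.Theory Num.Theory.
Import numFieldNormedType.Exports.

Set Implicit Arguments.
Unset Strict Implicit.
Unset Printing Implicit Defensive.

Local Open Scope classical_set_scope.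
Local Open Scope ring_scope.

(** Let W be the limit of the rescaled generation sizes of [tau].  If the root has
    k children, W is a constant multiple of the sum of the k independent copies of
    W that belong to the subtrees above the root ([limit_size_branch]); the constant
    is the inverse of the limit m of [r n.+1 / r n] ([norming_ratio]).  The theorem
    comes from the way in which such a sum can be small without being zero.  Let
    F(x) be the probability that 0 < W <= x.  It is positive, because one can
    condition on this event, and it tends to 0 with x ([small_cvg0]).  The
    probability of W = 0 is a fixed point of the generating function distinct from
    1, so it is c ([null_extinction]).

    Suppose c > 0.  A sum of k copies of W that is positive and at most m x has
    exactly one positive term, up to an event of probability O(F(m x)^2)
    ([prob_node_small]).  Summing over k gives F(x) / F(m x) --> f'(c)
    ([small_ratio]).  In the limit, the conditional probability that [tau] coincides
    with a given tree below height h therefore obeys a recursion: the subtree above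
    one child carries the positive mass, and those above the other children have
    W = 0 ([shape_small_limit]).  The law of the Kesten tree satisfies the same
    recursion ([marked_tree_shape]).

    Suppose c = 0, and let a be the least possible number of children.  All the
    terms of the sum are positive.  A root with more than a children forces one
    more term to be small, which costs a factor F(m x) that vanishes
    ([extra_child_le]).  If an event on trees is unlikely when W is small, it is also
    unlikely for each subtree when the sum is small, since the other terms are
    independent of that subtree ([rare_child_le]).  By induction on the height, the
    conditioned tree is a-ary below height h with a probability that tends to 1
    ([regular_small_limit]).

    Finally, the degrees of finitely many vertices are determined by the tree below
    some height.  There are countably many finite trees of that height and the limit
    law gives them total mass one ([tau0_finite]), so that no mass escapes and the
    expectations of bounded functions of the degrees converge
    ([local_cvg_from_shapes]). *)

(** * Degrees and generations of trees seen as sets of words *)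

Lemma counting_card (R : realType) (T : choiceType) (X : set T) n :
  (X #= `I_n)%card -> @counting _ R X = n%:R%:E.
Proof.
move=> Xn; have Xfin : finite_set X by exists n.
rewrite /counting asboolT//; congr (_%:R%:E).
by apply/card_eq_fsetP; rewrite fset_setK.
Qed.

Lemma counting_eq (R : realType) (T U : choiceType) (X : set T) (Y : set U) :
  (X #= Y)%card -> @counting _ R X = @counting _ R Y.
Proof.
move=> XY; have [[n Yn]|Yfin] := pselect (finite_set Y).
  by rewrite (counting_card _ Yn) (counting_card _ (card_eq_trans XY Yn)).
rewrite /counting !asboolF// => -[n Xn]; apply: Yfin; exists n.
by apply: card_eq_trans Xn; rewrite card_eq_sym.
Qed.

Lemma card_positive_le k : ([set i | (0 < i <= k)%N] #= `I_k)%card.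
Proof.
rewrite (_ : [set i | _] = succn @` `I_k).
  by apply: inj_card_eq => i j _ _ [].
by apply/seteqP; split=> [[|i]//= ?|_ [i /= ik <-]//]; exists i.
Qed.

Section tree_basics.
Variable R : realType.
Implicit Types (t : set (seq nat)) (u v : seq nat) (i j k n : nat).

Lemma num_children_notin t u : ~ t u -> num_children R t u = (-1)%:E.
Proof. by rewrite /num_children => tu; rewrite asboolF. Qed.

Lemma num_children_degree t u k : is_tree t -> t u ->
  (forall i, (0 < i)%N -> t (rcons u i) <-> (i <= k)%N) ->
  num_children R t u = k%:R%:E.
Proof.
move=> [tU _ _ _] tu tk; rewrite /num_children asboolT//.
rewrite (_ : [set i | _] = [set i | (0 < i <= k)%N]).
  exact: counting_card (card_positive_le k).
apply/seteqP; split=> [i /= ti|i /= /andP[i0 /tk]]; last exact.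
case: i ti => [/tU|i ti]; last by apply/tk.
by rewrite /ulam/= mem_rcons in_cons eqxx.
Qed.

Lemma num_children_infty t u : t u ->
  (forall i, (0 < i)%N -> t (rcons u i)) -> num_children R t u = +oo%E.
Proof.
move=> tu tk; rewrite /num_children asboolT// /counting asboolF// => ft.
apply: infinite_nat; rewrite -/(finite_set _).
have -> : [set: nat] = [set i | t (rcons u i)] `|` [set 0%N].
  by apply/seteqP; split=> // -[|i] _; [right|left; exact: tk].
by rewrite finite_setU.
Qed.

Lemma num_childrenP t u k : is_tree t ->
  num_children R t u = k%:R%:E <->
  t u /\ forall i, (0 < i)%N -> t (rcons u i) <-> (i <= k)%N.
Proof.
move=> tt; split=> [|[]]; last exact: num_children_degree.
have [tu|tu] := pselect (t u); last first.
  rewrite num_children_notin// => -[] ek.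
  by have := ler0n R k; rewrite -ek oppr_ge0 ler10.
have [_ _ _ /(_ u tu)[[m|] tm]] := tt.
  by rewrite (num_children_degree tt tu tm) => -[] /eqP; rewrite eqr_nat => /eqP <-.
by rewrite num_children_infty// => i /tm ->.
Qed.

(** Enumeration of the possible values -1, oo, 0, 1, 2, ... of
    [num_children]. *)
Definition degree_value (n : nat) : \bar R :=
  match n with 0 => (-1)%:E | 1 => +oo%E | k.+2 => k%:R%:E end.

Lemma num_children_value t u : is_tree t ->
  exists n, num_children R t u = degree_value n.
Proof.
move=> tt; have [tu|tu] := pselect (t u); last first.
  by exists 0%N; rewrite num_children_notin.
have [_ _ _ /(_ u tu)[[m|] tm]] := tt.
  by exists m.+2; apply: num_children_degree.
by exists 1%N; rewrite num_children_infty// => i /tm ->.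
Qed.

Lemma subtree_tree t i : is_tree t -> t [:: i] -> is_tree (subtree t i).
Proof.
move=> [tU t0 tp tk] ti; split=> //.
- by move=> u /tU; rewrite /ulam/= in_cons => /norP[].
- by move=> u v; exact: (tp (i :: u) v).
- by move=> u; exact: (tk (i :: u)).
Qed.

Lemma measurable_vertex u : measurable [set t : tree_space | t u].
Proof. by apply: sub_sigma_algebra; exists u. Qed.

Lemma measurable_subtree i :
  measurable_fun [set: tree_space] (fun t : tree_space => subtree t i : tree_space).
Proof.
apply: (@measurability _ _ tree_space tree_space _ _ tree_cylinders) => //.
move=> _ [_ [u _ <-] <-]; rewrite setTI; exact: (measurable_vertex (i :: u)).
Qed.

End tree_basics.

HB.instance Definition _ := isPointed.Build (seq nat) [::].

(** The discrete sigma-algebra on words makes counting a measure, so that its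
    countable additivity is available for generations. *)
Definition words := g_sigma_algebraType [set: set (seq nat)].

Lemma measurable_words (A : set words) : measurable A.
Proof. exact: sub_sigma_algebra. Qed.

Section generations.
Variable R : realType.
Implicit Types (t : set (seq nat)) (u v : seq nat) (i j k n : nat).

Lemma gen_size0 t : gen_size R t 0 = if `[< t [::] >] then 1%E else 0%E.
Proof.
rewrite /gen_size; case: ifPn => /asboolP t0.
  apply: (@counting_card _ _ _ 1%N); rewrite (_ : [set u | _] = [set [::]]).
    exact: card_set1.
  by apply/seteqP; split=> [u [_ /size0nil]|_ ->].
apply: (@counting_card _ _ _ 0%N); rewrite (_ : [set u | _] = set0) ?II0//.
by apply/seteqP; split=> // u [+ /size0nil u0]; rewrite u0.
Qed.

Lemma gen_size_ge0 t n : (0 <= gen_size R t n)%E.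
Proof. exact: (@measure_ge0 _ words R (@counting words R)). Qed.

(** Sorting the words of generation [n.+1] by their first letter; being an identity
    for arbitrary sets of words, it gives measurability on the whole tree space. *)
Lemma gen_sizeS t n :
  gen_size R t n.+1 = (\sum_(i <oo) gen_size R (subtree t i) n)%E.
Proof.
rewrite {1}/gen_size.
pose F i : set words := cons i @` [set v | subtree t i v /\ size v = n].
rewrite (_ : [set u | _] = \bigcup_i F i); last first.
  apply/seteqP; split=> [[|i v] [tv] //= [sv]|_ [i _ [v [tv sv] <-]]].
    by exists i => //; exists v.
  by split=> //=; rewrite sv.
transitivity (\sum_(i <oo) @counting words R (F i))%E.
  apply: (@measure_semi_bigcup _ _ _ (@counting words R)).
  - by move=> i; exact: measurable_words.
  - by move=> i j _ _ [_ [[v _ <-] [w _ [->]]]].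
  - exact: measurable_words.
apply: eq_eseriesr => i _; apply: counting_eq.
by apply: inj_card_eq => v w _ _ [].
Qed.

Lemma measurable_gen_size n :
  measurable_fun [set: tree_space] (fun t : tree_space => gen_size R t n).
Proof.
elim: n => [|n IHn].
  apply: (eq_measurable_fun
    (fun t : tree_space => if `[< t [::] >] then 1%E else 0%E)) => [t _|].
    by rewrite gen_size0.
  apply: measurable_fun_ifT => //.
  apply: (measurable_fun_bool true); rewrite setTI.
  rewrite (_ : _ @^-1` _ = [set t : tree_space | t [::]]).
    exact: measurable_vertex.
  by apply/seteqP; split=> t /asboolP.
apply: (eq_measurable_fun
  (fun t : tree_space => (\sum_(i <oo) gen_size R (subtree t i) n)%E)) => [t _|].
  by rewrite gen_sizeS.
apply: (@ge0_emeasurable_sum _ _ _ _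
  (fun i (t : tree_space) => gen_size R (subtree t i) n) xpredT) => [i t _ _|i _].
  exact: gen_size_ge0.
by apply: (measurableT_comp IHn); exact: measurable_subtree.
Qed.

Lemma num_children_root t :
  num_children R t [::] = if `[< t [::] >] then gen_size R t 1 else (-1)%:E.
Proof.
rewrite /num_children/=; case: ifP => // _; apply: counting_eq.
rewrite card_eq_sym (_ : [set u | _] = (fun i => [:: i]) @` [set i | t [:: i]]).
  by apply: inj_card_eq => i j _ _ [].
apply/seteqP; split=> [u [+ su]|_ [i ti <-]//].
by case: u su => [|i [|]]//= _ ti; exists i.
Qed.

Lemma measurable_num_children u :
  measurable_fun [set: tree_space] (fun t : tree_space => num_children R t u).
Proof.
elim: u => [|i u IHu]; last first.
  exact: (measurableT_comp IHu (measurable_subtree i)).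
apply: (eq_measurable_fun (fun t : tree_space =>
  if `[< t [::] >] then gen_size R t 1 else (- 1)%:E)) => [t _|].
  by rewrite num_children_root.
apply: measurable_fun_ifT => //; last exact: measurable_gen_size.
apply: (measurable_fun_bool true); rewrite setTI.
rewrite (_ : _ @^-1` _ = [set t : tree_space | t [::]]).
  exact: measurable_vertex.
by apply/seteqP; split=> t /asboolP.
Qed.

Lemma measurable_num_children_eq u x :
  measurable [set t : tree_space | num_children R t u = x].
Proof.
have := measurable_num_children u measurableT (emeasurable_set1 x).
by rewrite setTI.
Qed.

Lemma gen_size_branch t k n : is_tree t -> num_children R t [::] = k%:R%:E ->
  gen_size R t n.+1 = (\sum_(1 <= i < k.+1) gen_size R (subtree t i) n)%E.
Proof.
move=> tt /(num_childrenP R [::] k tt)[t0 tk]; rewrite gen_sizeS.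
have size0 i : ~ t [:: i] -> gen_size R (subtree t i) n = 0%E.
  move=> ti; rewrite /gen_size (_ : [set u | _] = set0).
    by apply: (@counting_card _ _ _ 0%N); rewrite II0.
  apply/seteqP; split=> // v [tv _]; apply: ti.
  by case: tt => _ _ tp _; exact: (tp [:: i] v).
rewrite (nneseries_split 0 k.+1); last by move=> i _; exact: gen_size_ge0.
rewrite add0n eseries0 ?adde0 => [|i /= ki _]; last first.
  apply: size0 => /= ti.
  have i0 : (0 < i)%N by apply: leq_ltn_trans ki.
  by move: (tk i i0) => [/(_ ti)]; rewrite leqNgt ki.
rewrite big_ltn// size0 ?add0e//.
by case: tt => tU _ _ _ /tU /negP; apply; rewrite mem_head.
Qed.

End generations.

(** * Bounded expectations along a countable partition *)

Section bounded_expectation.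
Context (R : realType) d (Om : measurableType d) (P : probability Om R).
Variables (X : Om -> R) (A : nat -> set Om) (x : nat -> R) (M : R).
Hypothesis mX : measurable_fun [set: Om] X.
Hypothesis XM : forall o, `|X o| <= M.
Hypothesis mA : forall n, measurable (A n).
Hypothesis tA : trivIset [set: nat] A.
Hypothesis XA : forall n o, A n o -> X o = x n.

Let integrableX (D : set Om) : measurable D -> P.-integrable D (EFin \o X).
Proof.
move=> mD; apply: measurable_bounded_integrable => //.
- by rewrite (le_lt_trans (probability_le1 P mD))// ltry.
- exact: measurable_funTS.
- exists M; split; first exact: num_real.
  by move=> y My o _; exact: le_trans (XM o) (ltW My).
Qed.

Lemma bounded_expectation_fin : ('E_P[X] \is a fin_num)%E.
Proof. by rewrite unlock; apply: integrable_fin_num => //; exact: integrableX. Qed.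

Let mD N : measurable (\big[setU/set0]_(n < N) A n).
Proof. exact: bigsetU_measurable. Qed.

Let PD N : fine (P (\big[setU/set0]_(n < N) A n)) = \sum_(n < N) fine (P (A n)).
Proof.
rewrite measure_bigsetU//.
by rewrite sum_fine// => n _; exact: fin_num_measure.
Qed.

(** On the first [N] cells [X] is constant, and elsewhere it is at most [M]. *)
Lemma bounded_expectation_partition N :
  `|fine 'E_P[X]%E - \sum_(n < N) x n * fine (P (A n))|
    <= M * (1 - \sum_(n < N) fine (P (A n))).
Proof.
have IN : \int[P]_(o in \big[setU/set0]_(n < N) A n) X o =
    \sum_(n < N) x n * fine (P (A n)).
  elim: N => [|N IH]; first by rewrite !big_ord0 Rintegral_set0.
  rewrite !big_ord_recr/= (Rintegral_setU (mD N) (mA N)); last 2 first.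
  - by apply: integrableX; apply: measurableU => //; exact: mD.
  - rewrite -bigcup_mkord; apply/disj_setPS => o [[n /= nN An] AN].
    have /(_ (ex_intro _ o (conj An AN))) nN' := tA (I : setT n) (I : setT N).
    by rewrite nN' ltnn in nN.
  rewrite IH; congr (_ + _).
  rewrite (@eq_Rintegral _ _ _ _ _ (cst (x N))) ?Rintegral_cst//.
  by move=> o; rewrite inE => /XA.
rewrite -IN -PD unlock -/(Rintegral _ _ _).
set D := \big[setU/set0]_(n < N) A n.
have mCD : measurable (~` D) by apply: measurableC; exact: mD.
have -> : \int[P]_o X o = \int[P]_(o in D) X o + \int[P]_(o in ~` D) X o.
  rewrite -Rintegral_setU ?setUv//; first exact: mD.
  - exact: integrableX.
  - by apply/disj_setPS; rewrite setICr.
rewrite addrAC subrr add0r.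
rewrite (le_trans (le_normr_Rintegral mCD _))//; first exact: integrableX.
have -> : 1 - fine (P D) = fine (P (~` D)).
  by rewrite probability_setC ?fineB//; [exact: fin_num_measure (mD N)|exact: mD].
rewrite -Rintegral_cst//; apply: le_Rintegral => //.
- by apply: integrable_norm; exact: integrableX.
- apply: measurable_bounded_integrable => //; last exact: bounded_cst.
  by rewrite (le_lt_trans (probability_le1 P mCD))// ltry.
Qed.

End bounded_expectation.

Lemma cvg_sum (R : realType) (I J : Type) (F : set_system I) {FF : Filter F}
    (r : seq J) (f : I -> J -> R) (l : J -> R) :
  (forall j, f i j @[i --> F] --> l j) ->
  \sum_(j <- r) f i j @[i --> F] --> \sum_(j <- r) l j.
Proof. by move=> fl; apply: cvg_big => // x; exact: add_continuous. Qed.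

(** When the limit weights [b] have total mass one no mass escapes, so the
    convergence of the individual weights forces that of the bounded
    expectations. *)
Lemma cvg_from_weights (R : realType) (I : Type) (F : set_system I)
    {FF : ProperFilter F} (e : I -> R) (e0 : R) (a : I -> nat -> R)
    (b x : nat -> R) (M : R) :
  0 <= M ->
  (\forall i \near F, forall N, `|e i - \sum_(n < N) x n * a i n|
     <= M * (1 - \sum_(n < N) a i n)) ->
  (forall N, `|e0 - \sum_(n < N) x n * b n| <= M * (1 - \sum_(n < N) b n)) ->
  (forall n, a i n @[i --> F] --> b n) ->
  \sum_(n < N) b n @[N --> \oo] --> (1 : R) ->
  e @ F --> e0.
Proof.
move=> M0 eF e0b ab b1; apply/cvgrPdist_lt => eps eps0.
have : M * (1 - \sum_(n < N) b n) @[N --> \oo] --> M * (1 - 1).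
  by apply: cvgMr; apply: cvgB => //; exact: cvg_cst.
rewrite subrr mulr0 => /cvgrPdist_lt/(_ (eps / 4)).
case; first by rewrite divr_gt0.
move=> N _ /(_ N (leqnn N)); rewrite /= sub0r normrN => tailN.
have saN : \sum_(n < N) a i n @[i --> F] --> \sum_(n < N) b n.
  by apply: cvg_sum => n; exact: ab.
have sxaN : \sum_(n < N) x n * a i n @[i --> F] --> \sum_(n < N) x n * b n.
  by apply: cvg_sum => n; apply: cvgMr; exact: ab.
have MaN : M * (1 - \sum_(n < N) a i n) @[i --> F] --> M * (1 - \sum_(n < N) b n).
  by apply: cvgMr; apply: cvgB => //; exact: cvg_cst.
have eps4 : 0 < eps / 4 by rewrite divr_gt0.
near=> i.
have h1 : `|\sum_(n < N) x n * b n - \sum_(n < N) x n * a i n| < eps / 4.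
  by near: i; exact: cvgr_dist_lt sxaN _ eps4.
have h2 : `|M * (1 - \sum_(n < N) b n) - M * (1 - \sum_(n < N) a i n)| < eps / 4.
  by near: i; exact: cvgr_dist_lt MaN _ eps4.
have h3 : `|e i - \sum_(n < N) x n * a i n| <= M * (1 - \sum_(n < N) a i n).
  by near: i; apply: filterS eF => i; exact.
have := e0b N; move: tailN h1 h2 h3.
set A := \sum_(n < N) x n * b n; set B := \sum_(n < N) x n * a i n.
set C := M * (1 - _); set D := M * (1 - _).
rewrite !ltr_norml !ler_norml.
move=> /andP[? ?] /andP[? ?] /andP[? ?] /andP[? ?] /andP[? ?].
by apply/andP; split; lra.
Unshelve. all: by end_near. Qed.

(** * Trees cut at a finite height *)

(** A plane tree cut at height [h] is the list of the trees cut at height [h - 1]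
    above its root; this presentation makes the type countable and matches the
    branching property. *)
Fixpoint tree_shape (h : nat) : countType :=
  if h is h'.+1 then (seq (tree_shape h') : countType) else (unit : countType).

Fixpoint regular_shape (a h : nat) : tree_shape h :=
  match h return tree_shape h with
  | 0 => tt
  | h'.+1 => nseq a (regular_shape a h') : seq (tree_shape h')
  end.

(* The child of rank [i] carries the letter [i.+1]. *)
Definition branch h (s : tree_shape h.+1) (i : nat) : tree_shape h :=
  nth (regular_shape 0 h) (s : seq (tree_shape h)) i.

Definition width h (s : tree_shape h.+1) : nat := size (s : seq (tree_shape h)).

(** The events for which the branching property gives a product formula. *)
Definition node_event (R : realType) (k : nat) (A : nat -> set tree_space) :
    set tree_space :=
  [set t | num_children R t [::] = k%:R%:E /\
           forall i, (1 <= i <= k)%N -> A i (subtree t i)].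

(** Only the number of children of the vertices of height less than [h] is
    prescribed. *)
Fixpoint shape_event (R : realType) (h : nat) : tree_shape h -> set tree_space :=
  match h return tree_shape h -> set tree_space with
  | 0 => fun=> setT
  | h'.+1 => fun s =>
      node_event R (width s) (fun i => shape_event R (branch s i.-1))
  end.

(** The value at height [h] and above is a dummy. *)
Fixpoint shape_degree (R : realType) (h : nat) (u : seq nat) {struct h} :
    tree_shape h -> \bar R :=
  match h return tree_shape h -> \bar R with
  | 0 => fun=> 0%E
  | h'.+1 => fun s =>
      if u is i :: v then
        if (0 < i <= width s)%N then shape_degree R v (branch s i.-1)
        else (-1)%:E
      else (width s)%:R%:E
  end.

Lemma measurable_node_event (R : realType) k A :
  (forall i, measurable (A i)) -> measurable (node_event R k A).
Proof.
move=> mA; rewrite (_ : node_event R k A =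
  [set t : tree_space | num_children R t [::] = k%:R%:E] `&`
  \bigcap_(i in [set i | (1 <= i <= k)%N])
    [set t : tree_space | A i (subtree t i)]); last first.
  by apply/seteqP; split.
apply: measurableI; first exact: measurable_num_children_eq.
apply: bigcap_measurableType => i _.
have := measurable_subtree i measurableT (mA i).
by rewrite setTI.
Qed.

Lemma measurable_shape_event (R : realType) h (s : tree_shape h) :
  measurable (shape_event R s).
Proof.
elim: h s => [|h IH] s; first exact: measurableT.
by apply: measurable_node_event => i; exact: IH.
Qed.

Lemma shape_event_inj (R : realType) h (s s' : tree_shape h) t :
  shape_event R s t -> shape_event R s' t -> s = s'.
Proof.
elim: h s s' t => [[] []//|h IH] s s' t /= [tk ts] [tk' ts'].
have sE : width s = width s'.
  by move: tk; rewrite tk' => -[] /eqP; rewrite eqr_nat => /eqP.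
apply: (@eq_from_nth _ (regular_shape 0 h)) => // i il.
apply: (IH _ _ (subtree t i.+1)); first exact: (ts i.+1).
by apply: (ts' i.+1); rewrite -sE.
Qed.

Lemma shape_event_degree (R : realType) h (s : tree_shape h) t u :
  is_tree t -> ulam u -> (size u < h)%N -> shape_event R s t ->
  num_children R t u = shape_degree R u s.
Proof.
elim: h s t u => // h IH s t [|i u] tt uU uh /= [tk ts]//.
have /(num_childrenP _ _ _ tt)[t0 ti] := tk.
have i0 : (0 < i)%N.
  by case: i uU {uh} => //; rewrite /ulam/= in_cons eqxx.
rewrite i0; case: ifPn => ik.
  apply: (IH _ (subtree t i)) => //.
  - by apply: subtree_tree => //; apply/ti.
  - by move: uU; rewrite /ulam/= in_cons => /norP[].
  - by apply: ts; rewrite i0.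
apply: num_children_notin => tiu; move/negP: ik; apply; apply/ti => //.
by case: tt => _ _ tp _; exact: (tp [:: i] u).
Qed.

Section regular.
Variables (R : realType) (a : nat).
Let T : set (seq nat) := regular_tree (a%:R%:E : \bar R).

Let regularE u : T u <-> all (fun i => 0 < i <= a)%N u.
Proof.
split=> [Tu|/allP Tu i /Tu /andP[i0 ia]]; last by rewrite lee_fin ler_nat.
by apply/allP => i /Tu [i0]; rewrite lee_fin ler_nat => ia; rewrite i0.
Qed.

Lemma regular_tree_is_tree : is_tree T.
Proof.
split.
- move=> u /regularE /allP Tu; apply/negP => /Tu.
  by rewrite ltnn.
- exact/regularE.
- by move=> u v /regularE; rewrite all_cat => /andP[? _]; exact/regularE.
- move=> u /regularE Tu; exists (Some a) => i i0; split.
    by move=> /regularE; rewrite all_rcons => /andP[/andP[]].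
  by move=> ia; apply/regularE; rewrite all_rcons i0 ia.
Qed.

Lemma regular_shape_event h : shape_event R (regular_shape a h) T.
Proof.
have T0 : T [::] by exact/regularE.
have Tdeg : num_children R T [::] = a%:R%:E.
  apply: num_children_degree => //; first exact: regular_tree_is_tree.
  move=> i i0; split=> [/regularE/=|ia]; first by rewrite i0 andbT.
  by apply/regularE; rewrite /= i0 ia.
elim: h => // h IH; split => /=; first by rewrite Tdeg /width size_nseq.
rewrite /width size_nseq => i ia; rewrite /branch nth_nseq.
case/andP: ia => i0 ia; rewrite (prednK i0) ia.
rewrite (_ : subtree T i = T)//.
apply/seteqP; split=> u; first by move=> /regularE /andP[_ /regularE].
by move=> /regularE Tu; apply/regularE; rewrite /= i0 ia.
Qed.

End regular.

(** * A criterion for local convergence *)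

(** The degrees range over countably many values, so the composition with an
    arbitrary function is measurable. *)
Lemma measurable_degrees_comp (R : realType) d (Om : measurableType d)
    (T : Om -> tree_space) (m : nat) (u : 'I_m -> seq nat)
    (g : ('I_m -> \bar R) -> R) : random_tree T ->
  measurable_fun [set: Om] (fun o => g (fun j => num_children R (T o) (u j))).
Proof.
move=> [mT tT] _ B mB; rewrite setTI.
pose cell (N : {ffun 'I_m -> nat}) := \bigcap_j
  (T @^-1` [set t : tree_space | num_children R t (u j) = degree_value R (N j)]).
rewrite (_ : _ @^-1` _ = \bigcup_(N in
    [set N : {ffun 'I_m -> nat} | B (g (fun j => degree_value R (N j)))]) cell N).
  rewrite bigcup_mkcond; apply: countable_bigcupT_measurable => // N.
  case: ifP => // _; apply: fin_bigcap_measurable => // j _.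
  rewrite -[X in measurable X]setTI; apply: mT => //.
  exact: measurable_num_children_eq.
apply/seteqP; split=> [y By|y [N BN Ny]]; last first.
  have E : (fun j => num_children R (T y) (u j)) = (fun j => degree_value R (N j)).
    by apply/funext => j; apply: Ny.
  by rewrite /preimage/= E.
have /choice[N NP] j := num_children_value R (u j) (tT y).
have E : (fun j => num_children R (T y) (u j)) =
    (fun j => degree_value R ([ffun j => N j] j)).
  by apply/funext => j; rewrite ffunE NP.
exists [ffun j => N j]; first by move: By; rewrite /preimage/= E.
by move=> j _ /=; rewrite ffunE NP.
Qed.

(** The degrees of the vertices [u j] are constant on each shape of a large enough
    height; as the limit has finite degrees, its shapes have total mass one and
    [cvg_from_weights] applies. *)
Lemma local_cvg_from_shapes (R : realType) (I : Type) (F : set_system I)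
    {FF : ProperFilter F} (d : measure_display) (Om : I -> measurableType d)
    (P : forall i, probability (Om i) R) (T : forall i, Om i -> tree_space)
    (d0 : measure_display) (Om0 : measurableType d0) (P0 : probability Om0 R)
    (T0 : Om0 -> tree_space) :
  (\forall i \near F, random_tree (T i)) -> random_tree T0 ->
  (forall h (s : tree_shape h), fine (P i (T i @^-1` shape_event R s)) @[i --> F] -->
    fine (P0 (T0 @^-1` shape_event R s))) ->
  (forall h, P0 (T0 @^-1` [set t | exists s : tree_shape h, shape_event R s t]) = 1%E) ->
  local_cvg_distr F P T P0 T0.
Proof.
move=> rT [mT0 tT0] cvgs tot m u g uU _ [M0 [_ gM0]].
set M := `|M0| + 1.
have gM x : `|g x| <= M.
  by apply: (gM0 M) => //; rewrite /M (le_lt_trans (ler_norm M0))// ltrDl.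
(* A vertex of height less than h has its degree fixed by the shape. *)
pose h := (\max_(j < m) size (u j)).+1.
pose ev (n : nat) : set tree_space :=
  if pickle_inv n is Some s then shape_event R (s : tree_shape h) else set0.
pose x (n : nat) : R := if pickle_inv n is Some s
  then g (fun j => shape_degree R (u j) (s : tree_shape h)) else 0.
have mev n : measurable (ev n).
  by rewrite /ev; case: pickle_inv => // s; exact: measurable_shape_event.
have tev : trivIset [set: nat] ev.
  move=> n n' _ _ [t []]; rewrite /ev.
  have := @pickle_invK (tree_shape h) n; have := @pickle_invK (tree_shape h) n'.
  case: pickle_inv => //= s' <-; case: pickle_inv => //= s <- ts ts'.
  by rewrite (@shape_event_inj R h s s' t ts ts').
have evx t n : is_tree t -> ev n t -> g (fun j => num_children R t (u j)) = x n.
  move=> tt; rewrite /ev /x; case: pickle_inv => // s ts.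
  congr g; apply/funext => j; apply: (@shape_event_degree R h s) => //.
  by rewrite ltnS (leq_bigmax j).
have meas d' (Om' : measurableType d') (T' : Om' -> tree_space) : random_tree T' ->
    forall n, measurable (T' @^-1` ev n).
  by move=> [mT' _] n; rewrite -[X in measurable X]setTI; exact: mT'.
have tev' d' (Om' : measurableType d') (T' : Om' -> tree_space) :
    trivIset [set: nat] (fun n => T' @^-1` ev n).
  by move=> n n' _ _ [y [on on']]; apply: tev => //; exists (T' y).
have fins d' (Om' : measurableType d') (P' : probability Om' R)
    (T' : Om' -> tree_space) : random_tree T' ->
    ('E_P'[fun o => g (fun j => num_children R (T' o) (u j))] \is a fin_num)%E.
  move=> rT'; apply: (@bounded_expectation_fin _ _ _ _ _ M) => //.
  exact: measurable_degrees_comp.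
have approx d' (Om' : measurableType d') (P' : probability Om' R)
    (T' : Om' -> tree_space) N : random_tree T' ->
    `|fine 'E_P'[fun o => g (fun j => num_children R (T' o) (u j))]%E
       - \sum_(n < N) x n * fine (P' (T' @^-1` ev n))|
     <= M * (1 - \sum_(n < N) fine (P' (T' @^-1` ev n))).
  move=> rT'; apply: (@bounded_expectation_partition _ _ _ P' _ (fun n => T' @^-1` ev n) x M) => //.
  - exact: measurable_degrees_comp.
  - exact: meas.
  - by move=> n o on; apply: evx => //; case: rT'.
rewrite -[X in _ --> X]fineK; last exact: fins.
apply/fine_cvgP; split; first by apply: filterS rT => i; exact: fins.
apply: (cvg_from_weights (x := x) (M := M)
  (a := fun i n => fine (P i (T i @^-1` ev n)))
  (b := fun n => fine (P0 (T0 @^-1` ev n)))).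
- by rewrite /M addr_ge0.
- by apply: filterS rT => i rTi N; exact: approx.
- by move=> N; exact: approx.
- move=> n; rewrite /ev; case: pickle_inv => [s|]; first exact: cvgs.
  under eq_cvg do rewrite preimage_set0 measure0.
  by rewrite preimage_set0 measure0; exact: cvg_cst.
- have : \sum_(0 <= n < N) P0 (T0 @^-1` ev n) @[N --> \oo] --> 1%E.
    rewrite -(tot h) (_ : _ @^-1` _ = \bigcup_n (T0 @^-1` ev n)).
      apply: measure_semi_sigma_additive; [exact: meas|exact: tev'|].
      by apply: bigcupT_measurable; exact: meas.
    apply/seteqP; split=> o [].
      by move=> s so; exists (pickle s) => //=; rewrite /ev pickleK_inv.
    by move=> n _ /=; rewrite /ev; case: pickle_inv => // s so; exists s.
  move=> /fine_cvgP[_]; apply: cvg_trans; apply: near_eq_cvg.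
  apply: nearW => N /=; rewrite big_mkord sum_fine// => n _.
  by apply: fin_num_measure; exact: meas.
Qed.

(** * The offspring generating function and the norming sequence *)

Lemma nneseries_series (R : realType) (u : nat -> R) (l : R) :
  (forall k, 0 <= u k) -> (\sum_(0 <= k <oo) (u k)%:E = l%:E)%E ->
  series u @ \oo --> l.
Proof.
move=> u0 ul; have cvgu : cvgn (fun n => \sum_(0 <= k < n) (u k)%:E)%E.
  by apply: is_cvg_nneseries => n _ _; rewrite lee_fin.
have : (\sum_(0 <= k < n) (u k)%:E)%E @[n --> \oo] --> l%:E by rewrite -ul.
move=> /fine_cvgP[_]; apply: cvg_trans; apply: near_eq_cvg; apply: nearW => n /=.
by rewrite sumEFin.
Qed.

(** (1 - s ^+ k) / (1 - s) as a polynomial in [s]. *)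
Definition geom_sum (R : realType) (s : R) (k : nat) : R := \sum_(i < k) s ^+ i.

Section geom_sum.
Variable R : realType.
Implicit Types s t : R.

Lemma geom_sumE s k : 1 - s ^+ k = (1 - s) * geom_sum s k.
Proof.
by have := subrX1 s k; rewrite -/(geom_sum s k) => h; rewrite -opprB h -mulNr opprB.
Qed.

Lemma geom_sum_ge0 s k : 0 <= s -> 0 <= geom_sum s k.
Proof. by move=> s0; apply: sumr_ge0 => i _; exact: exprn_ge0. Qed.

Lemma geom_sum_le s t k : 0 <= s <= t -> geom_sum s k <= geom_sum t k.
Proof.
move=> /andP[s0 st]; apply: ler_sum => i _; exact: lerXn2r (le_trans s0 st) st.
Qed.

Lemma geom_sum_lt s t k : 0 <= s < t -> (1 < k)%N -> geom_sum s k < geom_sum t k.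
Proof.
case: k => [|[|k]]// /andP[s0 st] _; rewrite /geom_sum !big_ord_recl /= !expr0 !expr1.
rewrite ltrD2l ltr_leD//; apply: ler_sum => i _.
by apply: lerXn2r; rewrite ?nnegrE ?(le_trans s0)// ltW.
Qed.

Lemma geom_sum_le_nat s k : 0 <= s <= 1 -> geom_sum s k <= k%:R.
Proof.
move=> /(@geom_sum_le s 1 k); rewrite /geom_sum; under [X in _ <= X]eq_bigr do rewrite expr1n.
by rewrite sumr_const card_ord.
Qed.

End geom_sum.

Section offspring.
Variables (R : realType) (p : nat -> R).
Hypothesis p_pmf : is_pmf p.
Hypothesis p_mean : (1 < mean p < +oo)%E.

Local Notation p_ge0 := (p_pmf.1).

Lemma pmf_series : series p @ \oo --> (1 : R).
Proof. by apply: nneseries_series p_pmf.2 => k; exact: p_ge0. Qed.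

Lemma mean_series : series (fun k => k%:R * p k) @ \oo --> fine (mean p).
Proof.
apply: nneseries_series => [k|]; first by rewrite mulr_ge0// p_ge0.
have /andP[m1 moo] := p_mean.
rewrite -[LHS]/(mean p) fineK// ge0_fin_numE// (le_trans _ (ltW m1))//.
Qed.

(** Series of the form E[u(k)], for [k] of law [p]; all those met here have
    a sequence [u] of at most linear growth. *)
Definition offspring_mean (u : nat -> R) : R := limn (series (fun k => p k * u k)).

Lemma offspring_cvg (u : nat -> R) : (forall k, 0 <= u k <= k%:R) ->
  cvgn (series (fun k => p k * u k)).
Proof.
move=> u0; have p0 := p_ge0.
apply: (@series_le_cvg _ _ (fun k => k%:R * p k)).
- by move=> k; have /andP[? _] := u0 k; rewrite mulr_ge0.
- by move=> k; rewrite mulr_ge0.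
- by move=> k; have /andP[_ ?] := u0 k; rewrite mulrC ler_wpM2r.
- by apply/cvg_ex; eexists; exact: mean_series.
Qed.

Lemma genfun_cvg (s : R) : 0 <= s <= 1 -> cvgn (series (fun k => p k * s ^+ k)).
Proof.
move=> /andP[s0 s1]; have p0 := p_ge0; apply: (@series_le_cvg _ _ p) => //.
- by move=> k; rewrite mulr_ge0// exprn_ge0.
- by move=> k; rewrite ler_piMr// exprn_ile1.
- by apply/cvg_ex; eexists; exact: pmf_series.
Qed.

Lemma geom_sum_bounds (s : R) k : 0 <= s <= 1 -> 0 <= geom_sum s k <= k%:R.
Proof.
by move=> s01; rewrite geom_sum_le_nat// geom_sum_ge0//; case/andP: s01.
Qed.

(** The slope of the chord of the generating function between s and 1. *)
Definition slope (s : R) : R := offspring_mean (geom_sum s).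

Lemma genfunE (s : R) : 0 <= s <= 1 -> genfun p s = 1 - (1 - s) * slope s.
Proof.
move=> s01; apply/cvg_lim => //.
have cs := offspring_cvg (fun k => geom_sum_bounds k s01).
have : series p n - (1 - s) * series (fun k => p k * geom_sum s k) n @[n --> \oo]
    --> 1 - (1 - s) * slope s.
  by apply: cvgB; [exact: pmf_series|apply: cvgMr; exact: cs].
apply: cvg_trans; apply: near_eq_cvg; apply: nearW => n.
rewrite /series/= mulr_sumr -sumrB; apply: eq_bigr => k _.
by rewrite mulrCA -geom_sumE mulrBr mulr1 subKr.
Qed.

(** Otherwise the mean would be at most one. *)
Lemma branching_charge : exists2 k, (1 < k)%N & 0 < p k.
Proof.
apply: contrapT => nex; have /andP[+ _] := p_mean.
apply/negP; rewrite -leNgt.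
rewrite -p_pmf.2; apply: lee_nneseries => k _; rewrite lee_fin.
  by rewrite mulr_ge0// p_ge0.
case: k => [|[|k]]; rewrite ?mul0r ?mul1r ?p_ge0//.
have [->|pk] := eqVneq (p k.+2) 0; first by rewrite mulr0.
by case: nex; exists k.+2; rewrite // lt_def pk p_ge0.
Qed.

Lemma series_lt (u v : nat -> R) k : cvgn (series u) -> cvgn (series v) ->
  (forall n, u n <= v n) -> u k < v k -> limn (series u) < limn (series v).
Proof.
move=> cu cv uv uvk.
have cvu : cvgn (series (v - u)) by exact: is_cvg_seriesB.
rewrite -subr_gt0 -lim_seriesB//.
have : series (v - u) k.+1 <= limn (series (v - u)).
  apply: nondecreasing_cvgn_le => // ; apply: nondecreasing_series => n _ _.
  by rewrite subr_ge0.
apply: lt_le_trans; rewrite /series/= big_nat_recr//= ltr_wpDl ?subr_gt0//.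
by apply: sumr_ge0 => i _; rewrite subr_ge0.
Qed.

Lemma slope_lt (s t : R) : 0 <= s -> s < t -> t <= 1 -> slope s < slope t.
Proof.
move=> s0 st t1; have [k k1 pk] := branching_charge.
have s01 : 0 <= s <= 1 by rewrite s0 (le_trans (ltW st)).
have t01 : 0 <= t <= 1 by rewrite t1 (le_trans s0 (ltW st)).
apply: (@series_lt _ _ k).
- by apply: offspring_cvg => n; exact: geom_sum_bounds.
- by apply: offspring_cvg => n; exact: geom_sum_bounds.
- move=> n; apply: ler_wpM2l; first exact: p_ge0.
  by apply: geom_sum_le; rewrite s0 ltW.
- by rewrite ltr_pM2l//; apply: geom_sum_lt => //; rewrite s0.
Qed.

Lemma slope_le (s t : R) : 0 <= s -> s <= t -> t <= 1 -> slope s <= slope t.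
Proof.
move=> s0; rewrite le_eqVlt => /predU1P[->//|st] t1; apply/ltW.
exact: slope_lt.
Qed.

Lemma slope_gt0 (s : R) : 0 <= s <= 1 -> 0 < slope s.
Proof.
move=> s01; have [k k1 pk] := branching_charge.
have s0 : series (fun=> 0 : R) @ \oo --> (0 : R).
  rewrite (_ : series _ = cst 0); first exact: cvg_cst.
  by apply/funext => n; rewrite /series/= big1.
rewrite -(cvg_lim _ s0)//.
apply: (@series_lt _ _ k).
- by apply/cvg_ex; exists 0.
- by apply: offspring_cvg => n; exact: geom_sum_bounds.
- move=> n; rewrite mulr_ge0 ?p_ge0//.
  by have /andP[] := geom_sum_bounds n s01.
- rewrite mulr_gt0//; case: k k1 {pk} => // k _.
  rewrite /geom_sum big_ord_recl expr0 ltr_pwDl// sumr_ge0// => i _.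
  by rewrite exprn_ge0//; case/andP: s01.
Qed.

Lemma genfun_le (s t : R) : 0 <= s -> s <= t -> t <= 1 -> genfun p s <= genfun p t.
Proof.
move=> s0 st t1; apply: lim_series_le.
- by apply: genfun_cvg; rewrite s0 (le_trans st).
- by apply: genfun_cvg; rewrite t1 (le_trans s0).
- move=> n; apply: ler_wpM2l; first exact: p_ge0.
  by apply: lerXn2r; rewrite // nnegrE// (le_trans s0).
Qed.

(** The slope from (1, 1) increases strictly, so the graph of the generating
    function lies strictly below the diagonal between a fixed point and 1. *)
Lemma genfun_below (a s : R) : 0 <= a -> genfun p a = a -> a < s -> s < 1 ->
  genfun p s < s.
Proof.
move=> a0 fa ast s1; have a1 : a < 1 by exact: lt_trans s1.
have sa : slope a = 1.
  have := genfunE (_ : 0 <= a <= 1); rewrite fa a0 ltW// => /(_ isT) h.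
  apply: (@mulfI _ (1 - a)); first by rewrite subr_eq0 gt_eqF.
  by rewrite mulr1; lra.
rewrite genfunE; last by rewrite (ltW s1) (le_trans a0)// ltW.
have := slope_lt a0 ast (ltW s1); rewrite sa => h.
have : (1 - s) * 1 < (1 - s) * slope s by rewrite ltr_pM2l// subr_gt0.
lra.
Qed.

Lemma genfun_fixpoint_unique (a b : R) : 0 <= a < 1 -> 0 <= b < 1 ->
  genfun p a = a -> genfun p b = b -> a = b.
Proof.
move=> /andP[a0 a1] /andP[b0 b1] fa fb.
have [ab|ba|//] := ltgtP a b.
- by have := genfun_below a0 fa ab b1; rewrite fb ltxx.
- by have := genfun_below b0 fb ba a1; rewrite fa ltxx.
Qed.

Lemma is_cvg_series_behead (u : nat -> R) :
  cvgn (series u) -> cvgn (series (fun n => u n.+1)).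
Proof.
move=> /cvg_ex[l ul]; apply/cvg_ex; exists (l - u 0%N).
have : series u n.+1 - u 0%N @[n --> \oo] --> l - u 0%N.
  by apply: cvgB; [rewrite cvg_shiftS|exact: cvg_cst].
apply: cvg_trans; apply: near_eq_cvg; apply: nearW => n.
by rewrite /series/= big_nat_recl// addrC addKr.
Qed.

Section norming.
Variables (c : R) (r : nat -> R).
Hypothesis c_ext : is_extinction_prob p c.
Hypothesis r_norming : seneta_heyde p c r.

Let y n : R := (r n)^-1.
Let s n : R := expR (- y n).

Let y_gt0 n : 0 < y n.
Proof. by case: r_norming => _ r0 _; rewrite invr_gt0. Qed.

Let sE n : genfun p (s n.+1) = s n.
Proof.
case: r_norming => _ _ /(_ n).
by rewrite /s /y !mulN1r.
Qed.

Let s_gt0 n : 0 < s n. Proof. exact: expR_gt0. Qed.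

Let s_lt1 n : s n < 1. Proof. by rewrite /s -expR0 ltr_expR oppr_lt0. Qed.

Let s01 n : 0 <= s n <= 1. Proof. by rewrite !ltW. Qed.

Let s_gtc n : c < s n.
Proof.
case: c_ext => c0 c1 fc; case: r_norming => r0c rpos _.
elim: n => [|n IH].
  move: c0; rewrite le_eqVlt => /predU1P[<-//|c0].
  have lnc : 0 < - ln c by rewrite oppr_gt0 ln_lt0// c0.
  rewrite -(lnK c0) ltr_expR ltrNr /y.
  rewrite -(invrK (- ln c)) ltf_pV2 ?posrE ?invr_gt0//.
  by have := r0c c0; rewrite mulN1r invrN.
rewrite ltNge; apply/negP => snc.
have := genfun_le (ltW (s_gt0 _)) snc (ltW c1).
by rewrite sE fc leNgt IH.
Qed.

Let s_incr : {homo s : m n / (m <= n)%N >-> m <= n}.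
Proof.
apply/nondecreasing_seqP => n; case: c_ext => c0 c1 fc.
rewrite -{1}sE ltW//; apply: (genfun_below c0 fc) => //.
Qed.

(** The increasing sequence [s] has a limit above [c] at which the generating function
    is not below the diagonal. *)
Let s_cvg1 : s @ \oo --> (1 : R).
Proof.
case: c_ext => c0 c1 fc.
have cs : cvgn s.
  apply: nondecreasing_is_cvgn; first exact: s_incr.
  by exists 1 => _ [n _ <-]; rewrite ltW.
have sL n : s n <= limn s by exact: nondecreasing_cvgn_le.
suff : ~~ (limn s < 1).
  rewrite -leNgt => L1; have <- : limn s = 1; last exact: cs.
  by apply/le_anti; rewrite L1 andbT; apply: limr_le => //; apply: nearW => n; rewrite ltW.
apply/negP => L1.
have := genfun_below c0 fc (lt_le_trans (s_gtc 0) (sL 0%N)) L1.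
rewrite ltNge => /negP; apply; apply: limr_le => //; apply: nearW => n.
by rewrite -sE; apply: genfun_le (sL _) _; rewrite ltW.
Qed.

Let y_cvg0 : y @ \oo --> (0 : R).
Proof.
have -> : y = (fun n => - ln (s n)).
  by apply/funext => n; rewrite /s expRK opprK.
rewrite -oppr0; apply: cvgN; rewrite -(@ln1 R).
apply: continuous_cvg => //; exact: continuous_ln.
Qed.

Let rho n : R := (1 - s n) / y n.

Let rho_gt0 n : 0 < rho n.
Proof. by rewrite divr_gt0// subr_gt0. Qed.

Let rho_cvg1 : rho @ \oo --> (1 : R).
Proof.
apply: (@squeeze_cvgr _ _ _ _ (fun n => (1 + y n)^-1) (fun=> 1)).
- apply: nearW => n; have y1 : 0 < 1 + y n by rewrite addr_gt0.
  have ey : expR (y n) >= 1 + y n by exact: expR_ge1Dx.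
  have ey' : 1 - y n <= s n by exact: expR_ge1Dx.
  have syE : s n <= (1 + y n)^-1.
    by rewrite /s expRN lef_pV2// posrE// expR_gt0.
  rewrite /rho ler_pdivrMr// mul1r ler_pdivlMr//; apply/andP; split; last lra.
  have -> : (1 + y n)^-1 * y n = 1 - (1 + y n)^-1; last lra.
  apply: (mulfI (lt0r_neq0 y1)).
  by rewrite mulrA mulrBr divff ?lt0r_neq0// mulr1 mul1r addrAC subrr add0r.
- rewrite -[X in _ --> X]invr1; apply: cvgV => //.
  by rewrite -[X in _ --> X]addr0; apply: cvgD => //; exact: cvg_cst.
- exact: cvg_cst.
Qed.

(** Consecutive terms of [1 - exp (- 1 / r n)], which is equivalent to [1 / r n],
    have a slope of the generating function as their ratio; slopes are monotone and
    bounded. *)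
Lemma norming_ratio : exists2 m : R, 0 < m & r n / r n.+1 @[n --> \oo] --> m^-1.
Proof.
pose v n := slope (s n.+1).
have v_ge n : v 0%N <= v n.
  by apply: slope_le (ltW (s_lt1 _)); rewrite ?s_incr// ltW.
have cv : cvgn v.
  apply: nondecreasing_is_cvgn.
    by move=> i j ij; apply: slope_le (ltW (s_lt1 _)); rewrite ?s_incr// ltW.
  exists (slope 1) => _ [n _ <-]; apply: slope_le => //; exact: ltW.
have v0 n : 0 < v n by exact: slope_gt0.
have m0 : 0 < limn v.
  by apply: lt_le_trans (v0 0%N) _; apply: limr_ge => //; exact: nearW.
exists (limn v) => //.
have : rho n / rho n.+1 * (v n)^-1 @[n --> \oo] --> 1 / 1 * (limn v)^-1.
  apply: cvgM; last by apply: cvgV => //; rewrite gt_eqF.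
  by apply: cvgM => //; apply: cvgV => //; rewrite cvg_shiftS.
rewrite divr1 mul1r; apply: cvg_trans; apply: near_eq_cvg; apply: nearW => n.
have xE : 1 - s n = (1 - s n.+1) * v n by rewrite -sE genfunE// subKr.
have xn : 1 - s n.+1 != 0 by rewrite subr_eq0 gt_eqF.
have [yn yn1 vn] : [/\ y n != 0, y n.+1 != 0 & v n != 0] by rewrite !gt_eqF.
have -> : r n / r n.+1 = y n.+1 / y n by rewrite /y invrK mulrC.
have -> : rho n / rho n.+1 / v n =
    y n.+1 / y n * ((1 - s n.+1) / (1 - s n.+1)) * (v n / v n).
  by rewrite /rho xE invf_div; lra.
by rewrite !divff// !mulr1.
Qed.

End norming.

(** Termwise differentiation needs the second derived series to converge at some K
    beyond [c]; as the mean is finite, it suffices that (n + 1) K ^ n is bounded. *)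
Lemma derive1_genfun (c : R) : 0 < c < 1 ->
  derive1 (genfun p) c = offspring_mean (fun k => k%:R * c ^+ k.-1).
Proof.
move=> /andP[c0 c1]; have p0 := p_ge0.
have meancvg : cvgn (series (fun k => k%:R * p k)).
  by apply/cvg_ex; eexists; exact: mean_series.
have cS1 := is_cvg_series_behead meancvg.
have cS2 := is_cvg_series_behead cS1.
pose K := (c + 1) / 2.
have [K0 cK K1] : [/\ 0 < K, c < K & K < 1] by rewrite /K; split; lra.
have cp : cvgn (pseries p K) by apply: genfun_cvg; rewrite !ltW.
have cdp : cvgn (pseries (pseries_diffs p) K).
  apply: (series_le_cvg _ _ _ cS1) => n; rewrite /pseries_diffs.
  - by rewrite !mulr_ge0// exprn_ge0// ltW.
  - by rewrite mulr_ge0.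
  - by rewrite ler_piMr ?mulr_ge0// exprn_ile1// ltW.
have cddp : cvgn (pseries (pseries_diffs (pseries_diffs p)) K).
  have K10 : 0 <= (1 - K)^-1 by rewrite invr_ge0 subr_ge0 ltW.
  have cS2K : cvgn (series (fun n => (1 - K)^-1 * (n.+2%:R * p n.+2))).
    move: cS2 => /cvg_ex[l Sl]; apply/cvg_ex; exists ((1 - K)^-1 * l).
    have : (1 - K)^-1 * series (fun n => n.+2%:R * p n.+2) n @[n --> \oo]
      --> (1 - K)^-1 * l by exact: cvgMr.
    apply: cvg_trans; apply: near_eq_cvg; apply: nearW => n.
    by rewrite /series/= mulr_sumr.
  apply: (series_le_cvg _ _ _ cS2K) => n; rewrite /pseries_diffs.
  - by rewrite !mulr_ge0// exprn_ge0// ltW.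
  - by rewrite !mulr_ge0.
  - rewrite [leLHS](mulrAC n.+1%:R); apply: ler_wpM2r; first by rewrite mulr_ge0.
    rewrite -[leRHS]mul1r ler_pdivlMr ?subr_gt0//.
    have -> : n.+1%:R * K ^+ n = \sum_(i < n.+1) K ^+ n :> R.
      by rewrite sumr_const card_ord mulr_natl.
    apply: (@le_trans _ _ (geom_sum K n.+1 * (1 - K))).
      apply: ler_wpM2r; first by rewrite subr_ge0 ltW.
      apply: ler_sum => i _; apply: ler_wiXn2l; rewrite ?(ltW K0) ?(ltW K1)//.
      by rewrite -ltnS.
    by rewrite mulrC -geom_sumE gerBl exprn_ge0// ltW.
have cK' : `|c| < `|K| by rewrite !gtr0_norm.
have h := pseries_snd_diffs cp cdp cddp cK'.
rewrite derive1E (@derive_val _ _ _ _ _ _ _ h).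
have cdpc : cvgn (pseries (pseries_diffs p) c).
  by apply: is_cvg_pseries_inside cdp _.
have := pseries_diffs_equiv cdpc => /(cvg_lim _) <- //.
rewrite /offspring_mean; congr (limn (series _)); apply/funext => k.
by rewrite mulrAC mulrC.
Qed.

End offspring.

(** * The limit of the rescaled generation sizes *)

Section limit_size.
Variables (R : realType) (r : nat -> R) (m : R).
Hypothesis r_gt0 : forall n, 0 < r n.
Hypothesis m_gt0 : 0 < m.
Hypothesis r_ratio : r n / r n.+1 @[n --> \oo] --> m^-1.
Implicit Types t : set (seq nat).

Definition scaled_size t (n : nat) : \bar R := (gen_size R t n * ((r n)^-1)%:E)%E.

(** The limit of the rescaled generation sizes when it exists and is finite;
    as an upper limit it is a measurable function on the whole tree space. *)
Definition limit_size t : R := fine (limn_esup (scaled_size t)).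

Definition diverging : set tree_space :=
  [set t | limn_einf (scaled_size t) != limn_esup (scaled_size t)] `|`
  [set t | limn_esup (scaled_size t) = +oo%E].

Lemma scaled_size_ge0 t n : (0 <= scaled_size t n)%E.
Proof. by rewrite mule_ge0 ?gen_size_ge0// lee_fin invr_ge0 ltW. Qed.

Lemma limn_esup_scaled_ge0 t : (0 <= limn_esup (scaled_size t))%E.
Proof.
rewrite limn_esup_lim; apply: lime_ge; first exact: is_cvg_esups.
apply: nearW => n; apply: le_trans (scaled_size_ge0 t n) _.
by apply: ereal_sup_ubound; exists n => /=.
Qed.

Lemma limit_size_ge0 t : 0 <= limit_size t.
Proof. exact/fine_ge0/limn_esup_scaled_ge0. Qed.

Lemma measurable_scaled_size n :
  measurable_fun [set: tree_space] (fun t : tree_space => scaled_size t n).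
Proof.
by apply: emeasurable_funM; [exact: measurable_gen_size|exact: measurable_cst].
Qed.

Lemma measurable_limn_esup_scaled : measurable_fun [set: tree_space]
  (fun t : tree_space => limn_esup (scaled_size t)).
Proof.
apply: (@measurable_fun_limn_esup _ _ _ _ (fun n (t : tree_space) => scaled_size t n)).
exact: measurable_scaled_size.
Qed.

Lemma measurable_limn_einf_scaled : measurable_fun [set: tree_space]
  (fun t : tree_space => limn_einf (scaled_size t)).
Proof.
apply: (@measurableT_comp _ _ _ _ _ _ (-%E)%E); first exact: oppe_measurable.
apply: (@measurable_fun_limn_esup _ _ _ _ (fun n (t : tree_space) => - scaled_size t n)%E).
by move=> n; apply: measurableT_comp => //; exact: measurable_scaled_size.
Qed.

Lemma measurable_limit_size :
  measurable_fun [set: tree_space] (limit_size : tree_space -> R).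
Proof.
apply: (@measurableT_comp _ _ _ _ _ _ fine); first exact: fine_measurable.
exact: measurable_limn_esup_scaled.
Qed.

Lemma measurable_diverging : measurable diverging.
Proof.
apply: measurableU.
  rewrite -[X in measurable X]setTI; apply: emeasurable_fun_neq => //.
  - exact: measurable_limn_einf_scaled.
  - exact: measurable_limn_esup_scaled.
have := measurable_limn_esup_scaled measurableT (emeasurable_set1 +oo%E).
by rewrite setTI.
Qed.

Lemma cvg_limit_size t : ~ diverging t ->
  scaled_size t n @[n --> \oo] --> (limit_size t)%:E.
Proof.
move=> /not_orP[/negP/negPn/eqP infsup supoo].
have supfin : limn_esup (scaled_size t) \is a fin_num.
  by rewrite ge0_fin_numE ?limn_esup_scaled_ge0// ltey; apply/eqP.
rewrite /limit_size fineK//.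
apply: (squeeze_cvge (f := einfs (scaled_size t)) (h := esups (scaled_size t))).
- apply: nearW => n; apply/andP; split.
    by apply: ereal_inf_lbound; exists n => /=.
  by apply: ereal_sup_ubound; exists n => /=.
- by rewrite -infsup limn_einf_lim; exact: is_cvg_einfs.
- by rewrite limn_esup_lim; exact: is_cvg_esups.
Qed.

Lemma limit_sizeE t (l : R) : scaled_size t n @[n --> \oo] --> l%:E ->
  ~ diverging t /\ limit_size t = l.
Proof.
move=> tl; have [infE supE] := cvg_limn_einf_sup tl.
by rewrite /diverging /limit_size /= infE supE eqxx; split=> // -[].
Qed.

(** Generation [n.+1] of the tree is rescaled by [r n.+1], and the generations [n] of
    the subtrees by [r n]; hence the factor, the limit of [r n / r n.+1]. *)
Lemma limit_size_branch t k : is_tree t -> num_children R t [::] = k%:R%:E ->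
  ~ diverging t -> (forall i, (1 <= i <= k)%N -> ~ diverging (subtree t i)) ->
  limit_size t = m^-1 * \sum_(1 <= i < k.+1) limit_size (subtree t i).
Proof.
move=> tt tk ct ci.
have h1 : scaled_size t n.+1 @[n --> \oo] --> (limit_size t)%:E.
  by have := cvg_limit_size ct; rewrite -(cvg_shiftS (scaled_size t)).
have h2 : (\sum_(1 <= i < k.+1) scaled_size (subtree t i) n)%E @[n --> \oo] -->
    (\sum_(1 <= i < k.+1) (limit_size (subtree t i))%:E)%E.
  rewrite big_nat_cond; under eq_cvg do rewrite big_nat_cond.
  apply: cvg_nnesum => [i _|i]; first by apply: nearW => n; exact: scaled_size_ge0.
  by rewrite ltnS andbT => /ci /cvg_limit_size.
have h3 : (((r n / r n.+1)%:E * \sum_(1 <= i < k.+1) scaled_size (subtree t i) n)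
    @[n --> \oo] --> (m^-1 * \sum_(1 <= i < k.+1) limit_size (subtree t i))%:E)%E.
  rewrite EFinM -sumEFin; apply: cvgeM => //.
  - by rewrite sumEFin mule_def_fin.
  - by apply: cvg_EFin; [exact: nearW|exact: r_ratio].
suff h4 : scaled_size t n.+1 @[n --> \oo] -->
    (m^-1 * \sum_(1 <= i < k.+1) limit_size (subtree t i))%:E.
  apply: EFin_inj; apply: (cvg_unique _ h1 h4); exact: ereal_hausdorff.
move: h3; apply: cvg_trans; apply: near_eq_cvg; near=> n.
rewrite /scaled_size (gen_size_branch _ tt tk) ge0_sume_distrl; last first.
  by move=> i _; exact: gen_size_ge0.
rewrite ge0_sume_distrr; last by move=> i _; exact: scaled_size_ge0.
apply: eq_bigr => i _; rewrite muleCA -EFinM; congr (_ * _%:E)%E.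
by rewrite mulrAC divff ?mul1r// gt_eqF.
Unshelve. all: by end_near. Qed.

End limit_size.

Lemma eq_measure_up_to_negligible d (T : measurableType d) (R : realType)
    (mu : {measure set T -> \bar R}) (N A B : set T) :
  measurable A -> measurable B -> mu.-negligible N ->
  (forall x, ~ N x -> A x <-> B x) -> mu A = mu B.
Proof.
move=> mA mB [M [mM M0 NM]] AB.
have muM C : measurable C -> mu C = mu (C `\` M).
  move=> mC; rewrite (measureDI mu mC mM) [X in (_ + X)%E](_ : _ = 0%E) ?adde0//.
  apply/eqP; rewrite -measure_le0 -M0; apply: le_measure; rewrite ?inE//.
  exact: measurableI.
rewrite (muM A)// (muM B)//; congr (mu _); apply/seteqP.
by split=> x [Cx Mx]; split=> //; apply/(AB x) => // /NM.
Qed.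

(** A law on trees with the branching property, together with a functional
    [w] (here the limit of the rescaled generation sizes) which is additive over
    the subtrees above the root up to the factor [m^-1]. *)
Record branching_limit (R : realType) (p : nat -> R) (m : R)
    (nu : probability tree_space R) (w : tree_space -> R) : Prop := {
  branching_m_gt0 : 0 < m ;
  branching_ge0 : forall t, 0 <= w t ;
  branching_measurable : measurable_fun [set: tree_space] w ;
  branching_node : forall k A, (forall i, measurable (A i)) ->
    nu (node_event R k A) = ((p k)%:E * \prod_(1 <= i < k.+1) nu (A i))%E ;
  branching_additive (k : nat) :
    nu.-negligible [set t : tree_space | num_children R t [::] = k%:R%:E /\
      w t <> m^-1 * \sum_(1 <= i < k.+1) w (subtree t i)] }.

(** The norming limit [W] is defined on the probability space only; almost surely it
    is the value at [tau] of the functional [limit_size], and the sizes of the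
    subtrees above the root converge as well, since these have the law of [tau]. *)
Lemma GW_branching_limit (R : realType) (p r : nat -> R) (m : R)
    d (Om : measurableType d) (P : probability Om R) (T : Om -> tree_space)
    (W : Om -> R) :
  is_GW p P T -> is_norming_limit r P T W -> (forall n, 0 < r n) ->
  0 < m -> r n / r n.+1 @[n --> \oo] --> m^-1 ->
  exists2 nu : probability tree_space R, branching_limit p m nu (limit_size r) &
    forall A B, measurable A -> measurable B ->
      P (T @^-1` A `&` W @^-1` B) = nu (A `&` limit_size r @^-1` B).
Proof.
move=> [[mT tT] GW] [mW W0 WP] r0 m0 rm.
pose T' : {mfun Om >-> tree_space} := HB.pack T (isMeasurableFun.Build _ _ _ _ T mT).
have mpre A : measurable A -> measurable (T @^-1` A).
  by move=> mA; rewrite -[X in measurable X]setTI; apply: (mT measurableT).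
have conv : P.-negligible (T @^-1` diverging r `|`
    [set o | limit_size r (T o) <> W o]).
  apply: negligibleS WP => o oP /= cv; have [? ?] := limit_sizeE cv.
  by case: oP.
have mdiv := measurable_diverging r.
have div0 : P (T @^-1` diverging r) = 0%E.
  apply: measure_negligible; first exact: mpre.
  by apply: negligibleS conv; left.
exists (distribution P T') => [|A B mA mB].
  apply: Build_branching_limit => //.
  - by move=> t; exact: limit_size_ge0.
  - exact: measurable_limit_size.
  - move=> k; set S := [set t : tree_space | _].
    have mS : measurable S.
      rewrite (_ : S = [set t : tree_space | num_children R t [::] = k%:R%:E] `&`
        ~` ((fun t : tree_space => limit_size r t -
          m^-1 * \sum_(1 <= i < k.+1) limit_size r (subtree t i)) @^-1` [set 0])).
        apply: measurableI; first exact: measurable_num_children_eq.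
        apply: measurableC; rewrite -[X in measurable X]setTI.
        apply: measurable_funB => //; first exact: measurable_limit_size.
        apply: measurable_funM; first exact: measurable_cst.
        apply: (@measurable_sum _ _ _ _ _ _
          (fun i (t : tree_space) => limit_size r (subtree t i))) => i.
        apply: (@measurableT_comp _ _ _ _ _ _ (limit_size r : tree_space -> R)).
          exact: measurable_limit_size.
        exact: measurable_subtree.
      apply/seteqP; split=> t [tk /= wt]; split=> //=.
        by move=> /eqP; rewrite subr_eq0 => /eqP.
      by apply: contra_not wt => ->; rewrite subrr.
    apply/negligibleP => //; rewrite -[LHS]/(P (T @^-1` S)).
    apply: measure_negligible; first exact: mpre.
    pose bad i : set Om := T @^-1` node_event R k
      (fun j => if (j == i) && (1 <= i <= k)%N then diverging r else setT).
    have bad0 i : (1 <= i <= k)%N -> P (bad i) = 0%E.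
      move=> ik; rewrite /bad ik (_ : P _ = (p k)%:E * \prod_(1 <= j < k.+1)
        P (T @^-1` (if (j == i) && true then diverging r else setT)))%E; last first.
        by apply: GW => j; case: ifP.
      rewrite (big_rem i)/=; last by rewrite mem_index_iota ltnS.
      by rewrite eqxx div0 mul0e mule0.
    apply: (@negligibleS _ _ _ _ (T @^-1` diverging r `|`
      \bigcup_(i in [set i | (1 <= i <= k)%N]) bad i)); last first.
      apply: negligibleU; first by apply: negligibleS conv; left.
      rewrite bigcup_mkcond; apply: negligible_bigcup => i; case: ifPn; last first.
        by move=> _; exact: negligible_set0.
      rewrite inE => ik; apply/negligibleP; last exact: bad0.
      by apply: mpre; apply: measurable_node_event => j; case: ifP.
    move=> o [ok wo]; apply: contrapT => /not_orP[od ob]; apply: wo.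
    apply: limit_size_branch => //.
    move=> i ik di; apply: ob; exists i => //; split=> // j jk.
    by case: ifPn => // /andP[/eqP ->].
have mw : measurable_fun [set: tree_space] (limit_size r : tree_space -> R).
  exact: measurable_limit_size.
have mTA : measurable (T @^-1` A) by exact: mpre.
have mWB : measurable (W @^-1` B).
  by rewrite -[X in measurable X]setTI; exact: mW.
have mwB : measurable (limit_size r @^-1` B : set tree_space).
  by rewrite -[X in measurable X]setTI; exact: mw.
have mwTB : measurable (T @^-1` (limit_size r @^-1` B)) by exact: mpre.
apply: (eq_measure_up_to_negligible _ _ conv); [exact: measurableI..|].
move=> o /not_orP[_ /contrapT wo].
by rewrite /preimage/= wo.
Qed.

(** * One branching step *)

Definition prob (R : realType) d (T : measurableType d) (P : probability T R)
  (A : set T) : R := fine (P A).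

Section prob.
Context (R : realType) d (T : measurableType d) (P : probability T R).
Local Notation pr := (prob P).

Lemma probK A : measurable A -> (pr A)%:E = P A.
Proof. by move=> mA; rewrite /prob fineK// fin_num_measure. Qed.

Lemma prob_ge0 A : 0 <= pr A.
Proof. by rewrite fine_ge0. Qed.

Lemma prob_le1 A : measurable A -> pr A <= 1.
Proof. by move=> mA; rewrite -lee_fin probK// probability_le1. Qed.

Lemma prob0 : pr set0 = 0. Proof. by rewrite /prob measure0. Qed.

Lemma probT : pr setT = 1. Proof. by rewrite /prob probability_setT. Qed.

Lemma prob_mono A B : measurable A -> measurable B -> A `<=` B -> pr A <= pr B.
Proof.
move=> mA mB AB; rewrite -lee_fin !probK//.
by apply: le_measure; rewrite ?inE.
Qed.

Lemma prob_bigU_le (E : nat -> set T) n : (forall i, measurable (E i)) ->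
  pr (\big[setU/set0]_(i < n) E i) <= \sum_(i < n) pr (E i).
Proof.
move=> mE; rewrite -lee_fin probK; last exact: bigsetU_measurable.
rewrite -sumEFin (eq_bigr (fun i : 'I_n => P (E i))).
  exact: Boole_inequality.
by move=> i _; rewrite probK.
Qed.

Lemma prob_bigU (E : nat -> set T) n : (forall i, measurable (E i)) ->
  (forall i j x, E i x -> E j x -> (i < n)%N -> (j < n)%N -> i = j) ->
  pr (\big[setU/set0]_(i < n) E i) = \sum_(i < n) pr (E i).
Proof.
move=> mE Einj; pose E' i := if (i < n)%N then E i else set0.
have mE' i : measurable (E' i) by rewrite /E'; case: ifP.
rewrite (eq_bigr (fun i : 'I_n => E' i)); last by move=> i _; rewrite /E' ltn_ord.
rewrite (eq_bigr (fun i : 'I_n => pr (E' i))); last first.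
  by move=> i _; rewrite /E' ltn_ord.
apply: EFin_inj; rewrite probK; last exact: bigsetU_measurable.
rewrite -sumEFin (eq_bigr (fun i : 'I_n => P (E' i))); last first.
  by move=> i _; rewrite probK.
rewrite measure_bigsetU// => i j _ _ [x []]; rewrite /E'.
by case: ifP => // i_n Ei; case: ifP => // j_n Ej; apply: (Einj i j x).
Qed.

Lemma probU_le A B : measurable A -> measurable B -> pr (A `|` B) <= pr A + pr B.
Proof.
move=> mA mB; rewrite -lee_fin EFinD !probK//; last exact: measurableU.
exact: measureU2.
Qed.

End prob.

Section one_step.
Variables (R : realType) (p : nat -> R) (m : R).
Variables (nu : probability tree_space R) (w : tree_space -> R).
Hypothesis p_ge0 : forall k, 0 <= p k.
Hypothesis bl : branching_limit p m nu w.
Local Notation pr := (prob nu).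

Let m0 := branching_m_gt0 bl.
Let w0 := branching_ge0 bl.
Let mw := branching_measurable bl.

Definition small (x : R) : set tree_space := [set t | 0 < w t <= x].
Definition null : set tree_space := [set t | w t = 0].

Lemma measurable_w (B : set R) : measurable B -> measurable (w @^-1` B).
Proof. by move=> mB; rewrite -[X in measurable X]setTI; exact: (mw measurableT). Qed.

Lemma measurable_small x : measurable (small x).
Proof.
rewrite (_ : small x = w @^-1` `]0, x]%classic).
  by apply: measurable_w; exact: measurable_itv.
by apply/seteqP; split=> t /=; rewrite /small/= in_itv.
Qed.

Lemma measurable_null : measurable null.
Proof. exact: (measurable_w (measurable_set1 0)). Qed.

Lemma small_le x y : x <= y -> small x `<=` small y.
Proof. by move=> xy t /andP[t0 tx]; rewrite /small/= t0 (le_trans tx). Qed.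

Lemma prob_node k A : (forall i, measurable (A i)) ->
  pr (node_event R k A) = p k * \prod_(i < k) pr (A i.+1).
Proof.
move=> mA; apply: EFin_inj; rewrite probK; last exact: measurable_node_event.
rewrite (branching_node bl)// EFinM big_add1 big_mkord -prodEFin.
by congr (_ * _)%E; apply: eq_bigr => i _; rewrite probK.
Qed.

Definition branch_sum k (t : tree_space) : R := \sum_(i < k) w (subtree t i.+1).

Lemma measurable_branch_sum k : measurable_fun setT (branch_sum k).
Proof.
apply: (@measurable_sum _ _ _ _ _ _
  (fun (i : 'I_k) (t : tree_space) => w (subtree t i.+1))) => i.
by apply: (measurableT_comp mw); exact: measurable_subtree.
Qed.

(** The additivity of [w] holds almost surely only, which is enough for
    probabilities. *)
Lemma prob_node_limit k A (B : set R) : (forall i, measurable (A i)) ->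
  measurable B ->
  pr (node_event R k A `&` w @^-1` B) =
  pr (node_event R k A `&` (fun t => m^-1 * branch_sum k t) @^-1` B).
Proof.
move=> mA mB; congr fine; have mN := measurable_node_event R k mA.
apply: (eq_measure_up_to_negligible _ _ (branching_additive bl k)).
- by apply: measurableI => //; exact: measurable_w.
- apply: measurableI => //; rewrite -[X in measurable X]setTI.
  apply: (measurable_funM (measurable_cst _) (measurable_branch_sum k)) => //.
- move=> t Nt.
  have wE : num_children R t [::] = k%:R%:E -> w t = m^-1 * branch_sum k t.
    move=> tk; apply: contrapT => wt; apply: Nt; split=> //.
    by rewrite big_add1 big_mkord.
  by split=> -[[tk tA] tB]; split=> //; move: tB; rewrite /preimage/= wE.
Qed.

(** A sum of nonnegative terms vanishes exactly when all its terms do. *)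
Lemma prob_node_null k A : (forall i, measurable (A i)) ->
  pr (node_event R k A `&` null) = p k * \prod_(i < k) pr (A i.+1 `&` null).
Proof.
move=> mA; rewrite (@prob_node_limit _ _ [set 0])//.
rewrite -(@prob_node k (fun i => A i `&` null)); last first.
  by move=> i; apply: measurableI => //; exact: measurable_null.
congr (pr _); apply/seteqP; split=> t.
  move=> [[tk tA] /= /eqP]; rewrite mulf_eq0 invr_eq0 gt_eqF//= => /eqP.
  move=> /psumr_eq0P tw; split=> // -[|i]// ik; split; first exact: tA.
  by apply: (tw _ (Ordinal (ik : i < k)%N)) => //.
move=> [tk tA]; split; first by split=> // i ik; case: (tA i ik).
rewrite /preimage/= /branch_sum big1 ?mulr0// => i _.
by have [] := tA i.+1 (ltn_ord i).
Qed.

(** A positive sum has a positive term, and each term is at most the sum. *)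
Let branch_small k A x t : (node_event R k A `&`
    (fun t => m^-1 * branch_sum k t) @^-1` `]0, x]%classic) t ->
  exists2 i : 'I_k, 0 < w (subtree t i.+1) &
    forall j : 'I_k, w (subtree t j.+1) <= m * x.
Proof.
move=> [_ /=]; rewrite in_itv/= => /andP[s0 sx].
have s0' : 0 < branch_sum k t by rewrite -(pmulr_rgt0 _ (_ : 0 < m^-1))// invr_gt0.
have sx' : branch_sum k t <= m * x by rewrite -ler_pdivrMl.
have le_sum (j : 'I_k) : w (subtree t j.+1) <= branch_sum k t.
  by rewrite /branch_sum (bigD1 j)//= lerDl sumr_ge0.
have [[i wi]|noi] := pselect (exists i : 'I_k, 0 < w (subtree t i.+1)).
  by exists i => // j; exact: le_trans (le_sum j) sx'.
have : branch_sum k t = 0.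
  rewrite /branch_sum big1// => i _; apply/eqP; rewrite eq_le w0 andbT leNgt.
  by apply/negP => wi; apply: noi; exists i.
by move=> sum0; rewrite sum0 ltxx in s0'.
Qed.

Let small_pre x : small x = w @^-1` `]0, x]%classic.
Proof. by apply/seteqP; split=> t /=; rewrite /small/= in_itv. Qed.

Let ord_neq k (i j : 'I_k) : j != i -> (j.+1 == i.+1) = false.
Proof. by move=> ji; rewrite eqSS; exact: negbTE ji. Qed.

Lemma prob_node_small_le k A x : (forall i, measurable (A i)) ->
  pr (node_event R k A `&` small x) <= p k * (k%:R * pr (small (m * x))).
Proof.
move=> mA; rewrite small_pre prob_node_limit//.
pose A1 i j := if j == i.+1 then small (m * x) else setT : set tree_space.
have mA1 i j : measurable (A1 i j).
  by rewrite /A1; case: ifP => // _; exact: measurable_small.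
pose E i := node_event R k (A1 i).
have mE i : measurable (E i) by exact: measurable_node_event.
have prE (i : 'I_k) : pr (E i) = p k * pr (small (m * x)).
  rewrite prob_node// (bigD1 i)//= /A1 eqxx big1 ?mulr1// => j ji.
  by rewrite ord_neq// probT.
apply: (@le_trans _ _ (pr (\big[setU/set0]_(i < k) E i))).
  apply: prob_mono.
  - apply: measurableI; first exact: measurable_node_event.
    rewrite -[X in measurable X]setTI.
    by apply: (measurable_funM (measurable_cst _) (measurable_branch_sum k)).
  - exact: bigsetU_measurable.
  move=> t tG; have [i wi wj] := branch_small tG; case: tG => -[tk tA] _.
  rewrite -bigcup_mkord; exists i; rewrite //=; split=> // j jk.
  by rewrite /A1; case: ifPn => // /eqP ->; rewrite /small/= wi wj.
apply: (le_trans (prob_bigU_le nu k mE)).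
rewrite (eq_bigr (fun=> p k * pr (small (m * x)))); last by move=> i _; exact: prE.
by rewrite sumr_const card_ord -[leLHS]mulr_natl mulrCA.
Qed.

(** The probability that exactly one of the subtrees has a positive limit, and that
    this limit is at most [x]. *)
Definition one_positive k (A : nat -> set tree_space) x : R :=
  p k * \sum_(i < k) pr (A i.+1 `&` small x) *
    \prod_(j < k | j != i) pr (A j.+1 `&` null).

(** A positive but small sum has exactly one positive term, up to an event that
    is quadratic in the probability of being positive but small. *)
Lemma prob_node_small k A x : (forall i, measurable (A i)) ->
  one_positive k A (m * x) <= pr (node_event R k A `&` small x)
    <= one_positive k A (m * x) + p k * (k%:R * (k%:R * pr (small (m * x)) ^+ 2)).
Proof.
move=> mA; rewrite small_pre prob_node_limit//.
set y := m * x; set main := one_positive k A y; set G := _ `&` _.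
have mG : measurable G.
  apply: measurableI; first exact: measurable_node_event.
  rewrite -[X in measurable X]setTI.
  by apply: (measurable_funM (measurable_cst _) (measurable_branch_sum k)).
have msm := measurable_small y; have mnull := measurable_null.
pose A1 i j := if j == i.+1 then A j `&` small y else A j `&` null.
have mA1 i j : measurable (A1 i j) by rewrite /A1; case: ifP => _; exact: measurableI.
pose E i := node_event R k (A1 i).
have mE i : measurable (E i) by exact: measurable_node_event.
have prU : pr (\big[setU/set0]_(i < k) E i) = main.
  rewrite prob_bigU//; last first.
    move=> i j t [_ ti] [_ tj] ik jk.
    have := tj i.+1 ik; have := ti i.+1 ik; rewrite /A1 eqxx eqSS.
    case: ifPn => [/eqP//|_] [_ /andP[+ _]] [_ t0].
    by rewrite t0 ltxx.
  rewrite /main /one_positive mulr_sumr; apply: eq_bigr => i _.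
  rewrite prob_node// (bigD1 i)//= /A1 eqxx; congr (_ * (_ * _)).
  by apply: eq_bigr => j /ord_neq ->.
pose A2 i j l : set tree_space :=
  if (l == i.+1) || (l == j.+1) then small y else setT.
have mA2 i j l : measurable (A2 i j l) by rewrite /A2; case: ifP.
pose D i j := if i == j then set0 else node_event R k (A2 i j).
have mD i j : measurable (D i j).
  by rewrite /D; case: ifP => // _; exact: measurable_node_event.
have prD (i j : 'I_k) : pr (D i j) <= p k * pr (small y) ^+ 2.
  rewrite /D; case: ifPn => [_|ij]; first by rewrite prob0 mulr_ge0// sqr_ge0.
  rewrite prob_node// (bigD1 i)//= (bigD1 j)/=; last by rewrite eq_sym; exact: ij.
  rewrite /A2 !eqxx orbT/= big1 ?mulr1 ?expr2// => l /andP[/ord_neq -> /ord_neq ->].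
  by rewrite probT.
pose V i := \big[setU/set0]_(j < k) D i j.
have mV i : measurable (V i) by exact: bigsetU_measurable.
have prV : pr (\big[setU/set0]_(i < k) V i) <= p k * (k%:R * (k%:R * pr (small y) ^+ 2)).
  apply: (le_trans (prob_bigU_le nu k mV)).
  apply: (@le_trans _ _ (\sum_(i < k) \sum_(j < k) (p k * pr (small y) ^+ 2))).
    apply: ler_sum => i _; apply: (le_trans (prob_bigU_le nu k (mD i))).
    by apply: ler_sum => j _; exact: prD.
  by rewrite !sumr_const !card_ord -[leLHS]mulr_natl -[X in k%:R * X]mulr_natl; lra.
apply/andP; split; rewrite -prU.
  apply: prob_mono => //; first exact: bigsetU_measurable.
  move=> t; rewrite -bigcup_mkord => -[i /= ik [tk tA]].
  have wi : w (subtree t i.+1) = branch_sum k t.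
    rewrite /branch_sum (bigD1 (Ordinal ik))//= big1 ?addr0// => j ji.
    by have /= ne := ord_neq ji; have := tA j.+1 (ltn_ord j); rewrite /A1 ne => -[].
  have := tA i.+1 ik; rewrite /A1 eqxx => -[_ /andP[wi0 wiy]].
  split.
    by split=> // j jk; have := tA j jk; rewrite /A1; case: ifP => _ [].
  rewrite /preimage/= in_itv/= -wi mulr_gt0 ?invr_gt0//=.
  by rewrite ler_pdivrMl.
apply: (@le_trans _ _ (pr (\big[setU/set0]_(i < k) E i) +
    pr (\big[setU/set0]_(i < k) V i))); last by rewrite lerD2l.
apply: le_trans (probU_le nu _ _); [|exact: bigsetU_measurable..].
apply: prob_mono => //.
  by apply: measurableU; exact: bigsetU_measurable.
move=> t tG; have [i wi wj] := branch_small tG; case: tG => -[tk tA] _.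
have [[j [ji wj0]]|nj] :=
    pselect (exists j : 'I_k, j != i /\ 0 < w (subtree t j.+1)).
  right; rewrite -bigcup_mkord; exists i => //=; rewrite /V -bigcup_mkord.
  exists j => //=; rewrite /D ifF; last by apply/negbTE; rewrite eq_sym; exact: ji.
  split=> // l lk; rewrite /A2; case: ifPn => // /orP[] /eqP ->.
  - by rewrite /small/= wi; exact: wj.
  - by rewrite /small/= wj0; exact: wj.
left; rewrite -bigcup_mkord; exists i => //=; split=> // -[|j]// jk.
rewrite /A1; case: ifPn => [/eqP[ji]|ji]; split; try exact: tA.
  by rewrite ji /small/= wi; exact: wj.
apply/eqP; rewrite eq_le w0 andbT leNgt; apply/negP => wj0; apply: nj.
by exists (Ordinal (jk : j < k)%N).
Qed.

End one_step.

(** * Small values of the limit *)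

Lemma cvg_at_right0_scale (R : realType) (m : R) (f : R -> R) (l : R) : 0 < m ->
  f x @[x --> 0^'+] --> l -> f (m * x) @[x --> 0^'+] --> l.
Proof.
move=> m0; apply: cvg_comp => P [e /= e0 eP].
exists (e / m); first by rewrite /= divr_gt0.
move=> x /=; rewrite sub0r normrN => xe x0; apply: eP => /=; last exact: mulr_gt0.
by rewrite sub0r normrN normrM (gtr0_norm m0) mulrC -ltr_pdivlMr.
Qed.

(** The tails of all the series are bounded by those of the series of [M]. *)
Lemma cvg_series_dominated (R : realType) (I : Type) (F : set_system I)
    {FF : ProperFilter F} (a : I -> nat -> R) (b M : nat -> R) (S : I -> R) (l : R) :
  (\forall i \near F, forall k, 0 <= a i k <= M k) -> cvgn (series M) ->
  (\forall i \near F, series (a i) @ \oo --> S i) ->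
  series b @ \oo --> l ->
  (forall k, a i k @[i --> F] --> b k) -> S @ F --> l.
Proof.
move=> aM cM aS bl ab.
have bM k : 0 <= b k <= M k.
  have cb : cvg (a i k @[i --> F]) by apply/cvg_ex; exists (b k); exact: ab.
  rewrite -(cvg_lim _ (ab k))//; apply/andP; split.
    by apply: limr_ge => //; apply: filterS aM => i /(_ k) /andP[].
  by apply: limr_le => //; apply: filterS aM => i /(_ k) /andP[].
have tail (u : nat -> R) (s : R) N : (forall k, 0 <= u k <= M k) ->
    series u @ \oo --> s -> `|s - series u N| <= limn (series M) - series M N.
  move=> uM us; have cu : cvgn (series u) by apply/cvg_ex; exists s.
  have cMu : cvgn (series (M - u)) by exact: is_cvg_seriesB.
  have h1 : series u N <= s.
    rewrite -(cvg_lim _ us)//; apply: nondecreasing_cvgn_le => //.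
    by apply: nondecreasing_series => k _ _; have /andP[] := uM k.
  have h2 : series (M - u) N <= limn (series (M - u)).
    apply: nondecreasing_cvgn_le => //; apply: nondecreasing_series => k _ _.
    by have /andP[_] := uM k; rewrite subr_ge0.
  rewrite lim_seriesB// (cvg_lim _ us)// in h2.
  have h3 : series (M - u) N = series M N - series u N by rewrite /series/= sumrB.
  by rewrite ger0_norm ?subr_ge0//; lra.
apply/cvgrPdist_lt => eps eps0; have eps4 : 0 < eps / 4 by rewrite divr_gt0.
have [N _ /(_ N (leqnn N)) /= NP] :
    \forall N \near \oo, `|limn (series M) - series M N| < eps / 4.
  exact: cvgr_dist_lt cM _ eps4.
have aN : series (a i) N @[i --> F] --> series b N.
  by rewrite /series/= !big_mkord; under eq_cvg do rewrite big_mkord; exact: cvg_sum.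
near=> i.
have h1 : `|series b N - series (a i) N| < eps / 4.
  by near: i; exact: cvgr_dist_lt aN _ eps4.
have h2 : `|S i - series (a i) N| <= limn (series M) - series M N.
  apply: tail; first by near: i.
  by near: i.
have h3 := tail b l N bM bl.
move: NP h1 h2 h3; rewrite !ltr_norml !ler_norml.
move=> /andP[? ?] /andP[? ?] /andP[? ?] /andP[? ?].
by apply/andP; split; lra.
Unshelve. all: by end_near. Qed.

Section small_limit.
Variables (R : realType) (p : nat -> R) (m : R).
Variables (nu : probability tree_space R) (w : tree_space -> R).
Hypothesis p_pmf : is_pmf p.
Hypothesis bl : branching_limit p m nu w.
Local Notation pr := (prob nu).

Let p_ge0 := p_pmf.1.
Let m0 := branching_m_gt0 bl.
Let msmall := measurable_small bl.
Let mnull := measurable_null bl.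

(** The events [small w x] decrease to the empty set. *)
Lemma small_cvg0 : pr (small w x) @[x --> 0^'+] --> (0 : R).
Proof.
have h : nu (small w n.+1%:R^-1) @[n --> \oo] --> (0 : \bar R)%E.
  rewrite -(measure0 nu) -(_ : \bigcap_n small w n.+1%:R^-1 = set0).
    apply: nonincreasing_cvg_mu.
    - by rewrite (le_lt_trans (probability_le1 nu (msmall _)))// ltry.
    - by move=> n; exact: msmall.
    - by apply: bigcapT_measurable => n; exact: msmall.
    - move=> i j ij; apply/subsetPset; apply: small_le.
      by rewrite lef_pV2 ?posrE// ler_nat.
  apply/seteqP; split=> // t tn; have /andP[t0 _] := tn 0%N I.
  have [n _ /(_ n (leqnn n)) nP] := near_infty_natSinv_lt (PosNum t0).
  by have /andP[_] := tn n I; rewrite leNgt nP.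
move: h => /fine_cvgP[_ /cvgrPdist_lt h]; apply/cvgrPdist_lt => e e0.
have [n _ /(_ n (leqnn n))] := h e e0; rewrite /= sub0r normrN => ne.
near=> x; rewrite sub0r normrN ger0_norm ?prob_ge0//.
apply: le_lt_trans (ler_norm _) (le_lt_trans _ ne).
rewrite !ger0_norm ?prob_ge0//.
apply: prob_mono => //; apply: small_le.
by near: x; apply: nbhs_right_le; rewrite invr_gt0.
Unshelve. all: by end_near. Qed.

(** The weights [p k] have total mass one, hence the number of children of the root
    is almost surely finite. *)
Lemma prob_by_degree B : measurable B ->
  series (fun k => pr (node_event R k (fun=> setT) `&` B)) @ \oo --> pr B.
Proof.
move=> mB; pose E k := node_event R k (fun=> setT).
have mE k : measurable (E k) by exact: measurable_node_event.
have tE : trivIset [set: nat] E.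
  by move=> i j _ _ [t [[ti _] [tj _]]]; move: tj; rewrite ti => -[] /eqP; rewrite eqr_nat => /eqP.
have mUE : measurable (\bigcup_k E k) by exact: bigcupT_measurable.
have nuE : nu (\bigcup_k E k) = 1%E.
  rewrite measure_semi_bigcup// -p_pmf.2; apply: eq_eseriesr => k _.
  rewrite -[LHS]/(nu (node_event R k (fun=> setT))) (branching_node bl)//.
  by rewrite big1 ?mule1// => i _; rewrite probability_setT.
have -> : pr B = pr (\bigcup_k (E k `&` B)).
  rewrite -setI_bigcupl; congr fine.
  apply: (@eq_measure_up_to_negligible _ _ _ _ (~` \bigcup_k E k)) => //.
  - exact: measurableI.
  - apply/negligibleP; first exact: measurableC.
    by rewrite -[LHS]/(nu (~` \bigcup_k E k)) probability_setC// nuE subee.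
  - by move=> t /contrapT tE'; split=> [tB|[]].
have mEB k : measurable (E k `&` B) by exact: measurableI.
have tEB : trivIset [set: nat] (fun k => E k `&` B) by exact: trivIset_setIr.
apply: nneseries_series => [k|]; first exact: prob_ge0.
rewrite probK; last exact: bigcupT_measurable.
rewrite measure_semi_bigcup//; last exact: bigcupT_measurable.
by apply: eq_eseriesr => k _; rewrite probK//; exact: mEB.
Qed.

(** The limit vanishes at the root exactly when it vanishes above every child. *)
Lemma genfun_null : genfun p (pr (null w)) = pr (null w).
Proof.
apply/cvg_lim => //; have := prob_by_degree mnull; apply: cvg_trans.
apply: near_eq_cvg; apply: nearW => n; apply: eq_bigr => k _.
rewrite (prob_node_null bl)//; congr (_ * _).
by under eq_bigr do rewrite setTI; rewrite prodr_const card_ord.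
Qed.

Hypothesis small_gt0 : forall x, 0 < x -> 0 < pr (small w x).

Let cvg_small_scale : pr (small w (m * x)) @[x --> 0^'+] --> (0 : R).
Proof. exact: (cvg_at_right0_scale m0 small_cvg0). Qed.

(** Recursion for the conditional probabilities given that [w] is positive and
    small: exactly one of the subtrees carries the positive mass. *)
Lemma node_small_limit k A (kappa : nat -> R) : (forall i, measurable (A i)) ->
  (forall i, (i < k)%N -> pr (A i.+1 `&` small w x) / pr (small w x)
    @[x --> 0^'+] --> kappa i) ->
  pr (node_event R k A `&` small w x) / pr (small w (m * x)) @[x --> 0^'+] -->
    p k * \sum_(i < k) kappa i * \prod_(j < k | j != i) pr (A j.+1 `&` null w).
Proof.
move=> mA kappaP; pose L x := p k * \sum_(i < k)
  pr (A i.+1 `&` small w x) / pr (small w x) *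
    \prod_(j < k | j != i) pr (A j.+1 `&` null w).
have cL : L (m * x) @[x --> 0^'+] -->
    p k * \sum_(i < k) kappa i * \prod_(j < k | j != i) pr (A j.+1 `&` null w).
  apply: cvgMr; apply: cvg_sum => i; apply: cvgMl.
  exact: (cvg_at_right0_scale m0 (kappaP i (ltn_ord i))).
have cU : L (m * x) + p k * (k%:R * (k%:R * pr (small w (m * x)))) @[x --> 0^'+] -->
    p k * \sum_(i < k) kappa i * \prod_(j < k | j != i) pr (A j.+1 `&` null w).
  have h : p k * (k%:R * (k%:R * pr (small w (m * x)))) @[x --> 0^'+] -->
      p k * (k%:R * (k%:R * 0)) by do 3 apply: cvgMr; exact: cvg_small_scale.
  by rewrite !mulr0 in h; rewrite -[X in _ --> X]addr0; apply: cvgD.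
apply: (squeeze_cvgr _ cL cU); near=> x.
have mx0 : 0 < m * x by rewrite mulr_gt0//; near: x; exact: nbhs_right_gt.
have F0 := small_gt0 mx0.
have LE : L (m * x) * pr (small w (m * x)) = one_positive p nu w k A (m * x).
  rewrite /L /one_positive -mulrA mulr_suml; congr (_ * _); apply: eq_bigr => i _.
  by rewrite mulrAC divfK// gt_eqF.
have /andP[h1 h2] := prob_node_small p_ge0 bl k x mA.
rewrite ler_pdivlMr// ler_pdivrMr// LE h1/= (le_trans h2)//.
by rewrite mulrDl LE lerD2l; lra.
Unshelve. all: by end_near. Qed.

(** The sum over [k] of the one-step asymptotics with no condition on the subtrees;
    the terms are dominated by [k * p k], by the union bound. *)
Lemma small_ratio : (mean p < +oo)%E -> (1 < mean p)%E ->
  pr (small w x) / pr (small w (m * x)) @[x --> 0^'+] -->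
    offspring_mean p (fun k => k%:R * pr (null w) ^+ k.-1).
Proof.
move=> mean_fin mean1.
have p_mean : (1 < mean p < +oo)%E by rewrite mean1.
have q01 : 0 <= pr (null w) <= 1 by rewrite prob_ge0 prob_le1.
have cD : series (fun k => p k * (k%:R * pr (null w) ^+ k.-1)) @ \oo -->
    offspring_mean p (fun k => k%:R * pr (null w) ^+ k.-1).
  apply: (offspring_cvg p_pmf p_mean) => k.
  case/andP: q01 => q0 q1; rewrite mulr_ge0 ?exprn_ge0//=.
  by rewrite ler_piMr// exprn_ile1.
apply: (cvg_series_dominated (M := fun k => k%:R * p k) (a := fun x k =>
  pr (node_event R k (fun=> setT) `&` small w x) / pr (small w (m * x))) _ _ _ cD).
- near=> x => k.
  have mx0 : 0 < m * x by rewrite mulr_gt0//; near: x; exact: nbhs_right_gt.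
  rewrite divr_ge0 ?prob_ge0//= ler_pdivrMr; last exact: small_gt0.
  rewrite [k%:R * _]mulrC -mulrA.
  exact: (prob_node_small_le bl).
- by apply/cvg_ex; eexists; exact: (mean_series p_pmf p_mean).
- near=> x.
  have : series (fun k => pr (node_event R k (fun=> setT) `&` small w x)) n /
      pr (small w (m * x)) @[n --> \oo] --> pr (small w x) / pr (small w (m * x)).
    by apply: cvgMl; exact: prob_by_degree.
  apply: cvg_trans; apply: near_eq_cvg; apply: nearW => n.
  by rewrite /series/= mulr_suml.
- move=> k; have := @node_small_limit k (fun=> setT) (fun=> 1) (fun=> measurableT).
  rewrite (_ : \sum_(i < k) _ = k%:R * pr (null w) ^+ k.-1); last first.
    rewrite (eq_bigr (fun=> pr (null w) ^+ k.-1)) ?sumr_const ?card_ord ?mulr_natl//.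
    move=> i _; rewrite mul1r; under eq_bigr do rewrite setTI.
    by rewrite prodr_const cardC1 card_ord.
  apply => i _.
  have : (fun=> 1 : R) @ (0 : R)^'+ --> (1 : R) by exact: cvg_cst.
  apply: cvg_trans; apply: near_eq_cvg; near=> x.
  rewrite setTI divff// gt_eqF// small_gt0//; near: x; exact: nbhs_right_gt.
Unshelve. all: by end_near. Qed.

End small_limit.

(** * Shapes of the conditioned tree *)

Section shape_limit.
Variables (R : realType) (p : nat -> R) (m : R).
Variables (nu : probability tree_space R) (w : tree_space -> R).
Hypothesis p_pmf : is_pmf p.
Hypothesis bl : branching_limit p m nu w.
Local Notation pr := (prob nu).

(** The conditional probability of a shape in the limit: at each vertex of a
    distinguished line of descent one child carries on that line, while the
    trees above its siblings have limit zero. *)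
Fixpoint spine_weight (D : R) (h : nat) : tree_shape h -> R :=
  match h return tree_shape h -> R with
  | 0 => fun=> 1
  | h'.+1 => fun s => D^-1 * (p (width s) * \sum_(i < width s)
      spine_weight D (branch s i) *
        \prod_(j < width s | j != i) pr (shape_event R (branch s j) `&` null w))
  end.

Hypothesis small_gt0 : forall x, 0 < x -> 0 < pr (small w x).

Lemma shape_small_limit (D : R) h (s : tree_shape h) : D != 0 ->
  pr (small w x) / pr (small w (m * x)) @[x --> 0^'+] --> D ->
  pr (shape_event R s `&` small w x) / pr (small w x) @[x --> 0^'+] -->
    spine_weight D s.
Proof.
move=> D0 ratio; have m0 := branching_m_gt0 bl.
elim: h s => [|h IH] s.
  have : (fun=> 1 : R) @ (0 : R)^'+ --> (1 : R) by exact: cvg_cst.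
  apply: cvg_trans; apply: near_eq_cvg; near=> x.
  rewrite /= setTI divff// gt_eqF// small_gt0//; near: x; exact: nbhs_right_gt.
have h1 := node_small_limit p_pmf bl small_gt0
  (fun i => measurable_shape_event R (branch s i.-1))
  (fun i (_ : (i < width s)%N) => IH (branch s i)).
have h2 : (pr (small w x) / pr (small w (m * x)))^-1 *
    (pr (shape_event R s `&` small w x) / pr (small w (m * x)))
    @[x --> 0^'+] --> spine_weight D s by exact: (cvgM (cvgV D0 ratio) h1).
move: h2; apply: cvg_trans; apply: near_eq_cvg; near=> x.
have x0 : 0 < x by near: x; exact: nbhs_right_gt.
have F0 : pr (small w (m * x)) != 0 by rewrite gt_eqF// small_gt0// mulr_gt0.
by rewrite /= invf_div mulrC mulrA divfK.
Unshelve. all: by end_near. Qed.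

Lemma shape_null h (s : tree_shape h.+1) :
  pr (shape_event R s `&` null w) =
  p (width s) * \prod_(i < width s) pr (shape_event R (branch s i) `&` null w).
Proof.
rewrite (prob_node_null bl)// => i; exact: measurable_shape_event.
Qed.

End shape_limit.

(** * Two-type trees *)

Section typed_trees.
Variable R : realType.
Implicit Types (t : typed_tree_space bool) (x : bool) (k : nat).
Local Notation forget := (@forget_types bool).

Lemma measurable_typed_vertex u (v : option bool) :
  measurable [set t : typed_tree_space bool | t u = v].
Proof. by apply: sub_sigma_algebra; exists (u, v). Qed.

Lemma measurable_forget : measurable_fun [set: typed_tree_space bool]
  (forget : typed_tree_space bool -> tree_space).
Proof.
apply: (@measurability _ _ (typed_tree_space bool) tree_space _ _ tree_cylinders) => //.
move=> _ [_ [u _ <-] <-]; rewrite setTI.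
exact: measurableC (measurable_typed_vertex u None).
Qed.

Lemma measurable_forget_preimage (A : set tree_space) :
  measurable A -> measurable (forget @^-1` A : set (typed_tree_space bool)).
Proof.
by move=> mA; rewrite -[X in measurable X]setTI; exact: (measurable_forget measurableT).
Qed.

Lemma measurable_typed_subtree i : measurable_fun [set: typed_tree_space bool]
  (fun t => typed_subtree t i : typed_tree_space bool).
Proof.
apply: (@measurability _ _ (typed_tree_space bool) (typed_tree_space bool) setT
  (fun t => typed_subtree t i) (@typed_cylinders bool)) => //.
move=> _ [_ [[u v] _ <-] <-]; rewrite setTI.
exact: (measurable_typed_vertex (i :: u) v).
Qed.

Definition typed_node x (v : seq bool) (A : nat -> set (typed_tree_space bool)) :
    set (typed_tree_space bool) :=
  [set t | [/\ t [::] = Some x, forall i, t [:: i.+1] = onth v i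
    & forall i, (i < size v)%N -> A i (typed_subtree t i.+1)]].

Lemma measurable_typed_node x v A : (forall i, measurable (A i)) ->
  measurable (typed_node x v A).
Proof.
move=> mA; rewrite (_ : typed_node x v A =
  [set t | t [::] = Some x] `&` (\bigcap_i [set t | t [:: i.+1] = onth v i] `&`
    \bigcap_(i in [set i | (i < size v)%N]) [set t | A i (typed_subtree t i.+1)])).
  apply: measurableI; first exact: measurable_typed_vertex.
  apply: measurableI; first by apply: bigcapT_measurable => i; exact: measurable_typed_vertex.
  apply: bigcap_measurableType => i _.
  by have := measurable_typed_subtree i.+1 measurableT (mA i); rewrite setTI.
apply/seteqP; split=> t; first by move=> [t0 tv tA]; split=> //; split=> // i _; exact: tv.
by move=> [t0 [tv tA]]; split=> // i; exact: tv.
Qed.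

(** The children of the root are numbered by the positions in the word of types. *)
Lemma typed_node_degree x v A t : is_tree (forget t) -> typed_node x v A t ->
  num_children R (forget t) [::] = (size v)%:R%:E.
Proof.
move=> tt [t0 tv _]; apply: num_children_degree => //.
  by rewrite /forget_types/= t0.
move=> [|i]// _; rewrite /forget_types/= tv; split.
  by case E : (onth v i) => [y|]// _; rewrite -onthTE E.
by rewrite -onthTE; case: (onth v i).
Qed.

Lemma typed_node_inj x v v' A A' t :
  typed_node x v A t -> typed_node x v' A' t -> v = v'.
Proof.
move=> [_ tv _] [_ tv' _].
have E i : onth v i = onth v' i by rewrite -tv -tv'.
have le_size (a b : seq bool) : onth a =1 onth b -> (size a <= size b)%N.
  by move=> ab; rewrite -onthNE ab onthNE.
have sE : size v = size v' by apply/anti_leq; rewrite !le_size.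
apply: (@eq_from_nth _ true) => // i iv.
by rewrite -!odflt_onth E.
Qed.

End typed_trees.

Lemma prob_bigcup1 (R : realType) d (T : measurableType d) (P : probability T R)
    (E : nat -> set T) : (forall k, measurable (E k)) -> trivIset setT E ->
  series (fun k => prob P (E k)) @ \oo --> (1 : R) -> P (\bigcup_k E k) = 1%E.
Proof.
move=> mE tE E1; rewrite measure_semi_bigcup//; last exact: bigcupT_measurable.
apply/cvg_lim => //.
have : (series (fun k => prob P (E k)) n)%:E @[n --> \oo] --> 1%E.
  by apply: cvg_EFin => //; exact: nearW.
apply: cvg_trans; apply: near_eq_cvg; apply: nearW => n.
by rewrite /series/= -sumEFin; apply: eq_bigr => k _; rewrite probK.
Qed.

Section spine_tree.
Variables (R : realType) (p : nat -> R) (c : R).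
Variable Q : bool -> probability (typed_tree_space bool) R.
Hypothesis QGW : is_multitype_GW (kesten_offspring p c) Q.
Local Notation forget := (@forget_types bool).
Local Notation prQ x := (prob (Q x)).

(** The words of types that carry mass: a vertex of type s has exactly one child
    of type s, at position [i]; one of type e has children of type e only. *)
Definition type_word (x : bool) (k i : nat) : seq bool :=
  if x then mkseq (fun j => j == i) k else nseq k false.

Definition type_words (x : bool) (k : nat) : nat := if x then k else 1.

Lemma size_type_word x k i : size (type_word x k i) = k.
Proof. by case: x; rewrite /type_word ?size_mkseq ?size_nseq. Qed.

Lemma type_word_inj x k i j : (i < type_words x k)%N -> (j < type_words x k)%N ->
  type_word x k i = type_word x k j -> i = j.
Proof.
case: x => /=; last by case: i; case: j.
move=> ik jk /(congr1 (fun s => nth false s i)).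
by rewrite !nth_mkseq// eqxx => /esym/eqP.
Qed.

Lemma kesten_offspring_word x k i : (i < type_words x k)%N ->
  kesten_offspring p c x (type_word x k i) =
  if x then kesten_p1 p c k / k%:R else kesten_p p c k.
Proof.
move=> ik; rewrite /kesten_offspring size_type_word; case: x ik => /= ik.
  rewrite ifT// /mkseq count_map (eq_count (a2 := pred1 i)).
    by rewrite count_uniq_mem ?iota_uniq// mem_iota ik.
  by move=> j /=; rewrite eqb_id.
by rewrite ifT// count_nseq.
Qed.

Let mass x k := \sum_(i < type_words x k) kesten_offspring p c x (type_word x k i).

Hypothesis mass1 : forall x, series (mass x) @ \oo --> (1 : R).

Let N x k (A : nat -> set (typed_tree_space bool)) i := typed_node x (type_word x k i) A.

Let prN x k A i : (forall i, measurable (A i)) ->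
  prQ x (N x k A i) = kesten_offspring p c x (type_word x k i) *
    \prod_(j < k) prQ (nth x (type_word x k i) j) (A j).
Proof.
move=> mA; have [_ QE] := QGW x; apply: EFin_inj.
rewrite probK; last exact: measurable_typed_node.
rewrite EFinM -prodEFin -[LHS]/(Q x [set t : typed_tree_space bool | _]) QE//.
rewrite size_type_word; congr (_ * _)%E.
by apply: eq_bigr => j _; rewrite probK.
Qed.

Let U x k A : set (typed_tree_space bool) :=
  \big[setU/set0]_(i < type_words x k) N x k A i.

Let mU x k A : (forall i, measurable (A i)) -> measurable (U x k A).
Proof. by move=> mA; apply: bigsetU_measurable => i _; exact: measurable_typed_node. Qed.

Let prU x k A : (forall i, measurable (A i)) -> prQ x (U x k A) =
  \sum_(i < type_words x k) kesten_offspring p c x (type_word x k i) *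
    \prod_(j < k) prQ (nth x (type_word x k i) j) (A j).
Proof.
move=> mA; rewrite /U prob_bigU.
- by apply: eq_bigr => i _; rewrite prN.
- by move=> i; exact: measurable_typed_node.
- move=> i j t ti tj ik jk; exact: type_word_inj ik jk (typed_node_inj ti tj).
Qed.

Let setT_measurable (i : nat) : measurable ((fun=> setT) i : set (typed_tree_space bool)).
Proof. exact: measurableT. Qed.

Let prUT x k : prQ x (U x k (fun=> setT)) = mass x k.
Proof.
rewrite prU//; apply: eq_bigr => i _.
by rewrite big1 ?mulr1// => j _; rewrite probT.
Qed.

Let total x : Q x (\bigcup_k U x k (fun=> setT)) = 1%E.
Proof.
apply: prob_bigcup1.
- by move=> k; exact: mU.
- move=> k k' _ _ [t []]; rewrite /U -!bigcup_mkord => -[i _ ti] [j _ tj].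
  by have /(congr1 size) := typed_node_inj ti tj; rewrite !size_type_word.
- by rewrite (_ : (fun k => _) = mass x)//; apply/funext => k; exact: prUT.
Qed.

(** Almost surely the children of the root form one of the words [type_word x k i];
    given that the degree is [k], only the finitely many values of [i] remain. *)
Lemma prob_forget_node x k (A : nat -> set tree_space) :
  (forall i, measurable (A i)) ->
  prQ x (forget @^-1` node_event R k A) =
  \sum_(i < type_words x k) kesten_offspring p c x (type_word x k i) *
    \prod_(j < k) prQ (nth x (type_word x k i) j) (forget @^-1` A j.+1).
Proof.
move=> mA; have mA' i : measurable (forget @^-1` A i.+1 : set (typed_tree_space bool)).
  exact: measurable_forget_preimage.
rewrite -(@prU x k (fun j => forget @^-1` A j.+1))//; congr fine.
have [tree _] := QGW x.
have neg : (Q x).-negligible (~` (\bigcup_k U x k (fun=> setT)) `|`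
    ~` [set t | is_tree (forget t)]).
  apply: negligibleU => //; apply/negligibleP.
    by apply: measurableC; apply: bigcupT_measurable => k'; exact: mU.
  rewrite -[LHS]/(Q x (~` \bigcup_k' U x k' (fun=> setT))).
  rewrite probability_setC ?total ?subee//.
  by apply: bigcupT_measurable => k'; exact: mU.
apply: (eq_measure_up_to_negligible _ _ neg).
- by apply: measurable_forget_preimage; exact: measurable_node_event.
- exact: mU.
move=> t /not_orP[/contrapT tU /contrapT tt]; split=> [[tk tA]|].
  case: tU => k' _; rewrite /U -!bigcup_mkord => -[i ik' ti].
  have kE := typed_node_degree R tt ti.
  have kk' : k' = k.
    by move: kE; rewrite tk size_type_word => -[] /eqP; rewrite eqr_nat => /eqP ->.
  rewrite {}kk' in ik' ti; exists i => //; have [t0 tv _] := ti.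
  by split=> // j; rewrite size_type_word => jk; exact: (tA j.+1).
rewrite /U -bigcup_mkord => -[i ik ti]; split.
  by rewrite (typed_node_degree R tt ti) size_type_word.
have [_ _ tA] := ti; move=> [|j]// jk; apply: tA.
by rewrite size_type_word.
Qed.

Definition finite_below (h : nat) : set tree_space :=
  [set t | exists s : tree_shape h, shape_event R s t].

Lemma measurable_finite_below h : measurable (finite_below h).
Proof.
rewrite (_ : finite_below h = \bigcup_s shape_event R (s : tree_shape h)).
  apply: countable_bigcupT_measurable => // s; exact: measurable_shape_event.
by apply/seteqP; split=> t [s]; exists s.
Qed.

Lemma node_finite_below h k : node_event R k (fun=> finite_below h) `<=` finite_below h.+1.
Proof.
move=> t [tk tA].
have tA' (i : nat) : exists s : tree_shape h, (i < k)%N -> shape_event R s (subtree t i.+1).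
  have [ik|ik] := ltnP i k; last by exists (regular_shape 0 h).
  by have [s ts] := tA i.+1 ik; exists s.
have /choice[s sP] := tA'.
exists (mkseq s k : tree_shape h.+1); split; first by rewrite tk /width size_mkseq.
rewrite /width size_mkseq => -[|i]// ik.
by rewrite /branch nth_mkseq//; exact: sP.
Qed.

(** By induction on the height: the words of types have total mass one, and
    almost surely each subtree has finite degrees below the height [h]. *)
Lemma spine_tree_finite x h : Q x (forget @^-1` finite_below h) = 1%E.
Proof.
elim: h x => [|h IH] x.
  rewrite (_ : forget @^-1` _ = setT) ?probability_setT//.
  by apply/seteqP; split=> // t _; exists tt.
have mF := measurable_finite_below h.
pose E k : set (typed_tree_space bool) := forget @^-1` node_event R k (fun=> finite_below h).
have mE k : measurable (E k).
  by apply: measurable_forget_preimage; exact: measurable_node_event.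
have E1 : Q x (\bigcup_k E k) = 1%E.
  apply: prob_bigcup1 => //.
    move=> i j _ _ [t [[ti _] [tj _]]]; move: tj; rewrite ti => -[] /eqP.
    by rewrite eqr_nat => /eqP.
  rewrite (_ : (fun k => _) = mass x)//; apply/funext => k.
  rewrite prob_forget_node//; apply: eq_bigr => i _.
  by rewrite big1 ?mulr1// => j _; rewrite /prob IH.
apply/eqP; rewrite eq_le probability_le1/=; last first.
  by apply: measurable_forget_preimage; exact: measurable_finite_below.
rewrite -{1}E1; apply: le_measure; rewrite ?inE.
- exact: bigcupT_measurable.
- by apply: measurable_forget_preimage; exact: measurable_finite_below.
- by move=> t [k _ tk]; exact: node_finite_below tk.
Qed.

End spine_tree.

(** * The Kesten tree *)

Section kesten_tree.
Variables (R : realType) (p : nat -> R) (m c : R).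
Variables (nu : probability tree_space R) (w : tree_space -> R).
Hypothesis p_pmf : is_pmf p.
Hypothesis p_mean : (1 < mean p < +oo)%E.
Hypothesis bl : branching_limit p m nu w.
Hypothesis c01 : 0 < c < 1.
Hypothesis fc : genfun p c = c.
Hypothesis null_c : prob nu (null w) = c.
Variable Q : bool -> probability (typed_tree_space bool) R.
Hypothesis QGW : is_multitype_GW (kesten_offspring p c) Q.
Local Notation forget := (@forget_types bool).

Let c0 : 0 < c. Proof. by case/andP: c01. Qed.
Let cn0 : c != 0. Proof. by rewrite gt_eqF. Qed.
Let c_le : 0 <= c <= 1. Proof. by case/andP: c01 => *; rewrite !ltW. Qed.
Let D : R := offspring_mean p (fun k => k%:R * c ^+ k.-1).

Let D_series : series (fun k => p k * (k%:R * c ^+ k.-1)) @ \oo --> D.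
Proof.
apply: (offspring_cvg p_pmf p_mean) => k; case/andP: c_le => c0' c1.
by rewrite mulr_ge0 ?exprn_ge0//= ler_piMr// exprn_ile1.
Qed.

(** Some [k > 1] has positive weight, and [c > 0]. *)
Lemma spine_mean_gt0 : 0 < D.
Proof.
have [k k1 pk] := branching_charge p_pmf p_mean.
have : series (fun k => p k * (k%:R * c ^+ k.-1)) k.+1 <= D.
  rewrite -(cvg_lim _ D_series)//; apply: nondecreasing_cvgn_le.
    by apply: nondecreasing_series => n _ _; rewrite !mulr_ge0 ?p_pmf.1// exprn_ge0// ltW.
  by apply/cvg_ex; exists D; exact: D_series.
apply: lt_le_trans; rewrite /series/= big_nat_recr//= ltr_wpDl//.
  by apply: sumr_ge0 => i _; rewrite !mulr_ge0 ?p_pmf.1// exprn_ge0// ltW.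
by rewrite !mulr_gt0 ?ltr0n ?exprn_gt0//; exact: ltn_trans k1.
Qed.

Lemma kesten_pE k : kesten_p p c k = c ^+ k / c * p k.
Proof. by rewrite /kesten_p expfzDr. Qed.

Let kesten_p1E k : kesten_p1 p c k = p k * (k%:R * c ^+ k.-1) / D.
Proof.
rewrite /kesten_p1 (derive1_genfun p_pmf p_mean c01) -/D kesten_pE; congr (_ / _).
case: k => [|k]; first by rewrite !mul0r mulr0.
by rewrite exprSr mulfK//; lra.
Qed.

Let mass1 x : series (fun k => \sum_(i < type_words x k)
  kesten_offspring p c x (type_word x k i)) @ \oo --> (1 : R).
Proof.
have massE k : \sum_(i < type_words x k) kesten_offspring p c x (type_word x k i) =
    if x then p k * (k%:R * c ^+ k.-1) / D else p k * c ^+ k / c.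
  rewrite (eq_bigr (fun=> if x then kesten_p1 p c k / k%:R else kesten_p p c k)); last first.
    by move=> i _; rewrite kesten_offspring_word.
  rewrite sumr_const card_ord; case: x => /=.
    rewrite -[LHS]mulr_natl kesten_p1E; case: k => [|k]; first by rewrite !mul0r mulr0 mul0r.
    by rewrite mulrCA divff ?mulr1.
  by rewrite mulr1n kesten_pE mulrC mulrA.
rewrite (_ : (fun k => _) = (fun k => if x then p k * (k%:R * c ^+ k.-1) / D
  else p k * c ^+ k / c)); last by apply/funext.
have D0 : D != 0 by rewrite gt_eqF// spine_mean_gt0.
case: x {massE}.
  have : series (fun k => p k * (k%:R * c ^+ k.-1)) n / D @[n --> \oo] --> D / D.
    by apply: cvgMl; exact: D_series.
  rewrite divff//; apply: cvg_trans; apply: near_eq_cvg; apply: nearW => n.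
  by rewrite /series/= mulr_suml.
have : series (fun k => p k * c ^+ k) n / c @[n --> \oo] --> c / c.
  apply: cvgMl; rewrite -[X in _ --> X]fc; exact: (genfun_cvg p_pmf c_le).
rewrite divff//; apply: cvg_trans; apply: near_eq_cvg; apply: nearW => n.
by rewrite /series/= mulr_suml.
Qed.

Local Notation alpha s := (prob nu (shape_event R s `&` null w)).

(** A tree without marked vertices is [tau] conditioned to have limit zero; the
    weights of [kesten_p] are those of this conditioning. *)
Lemma unmarked_tree_shape h (s : tree_shape h) :
  prob (Q false) (forget @^-1` shape_event R s) = alpha s / c.
Proof.
elim: h s => [|h IH] s.
  by rewrite /= setTI null_c divff// preimage_setT probT.
rewrite (@prob_forget_node _ _ _ Q QGW mass1)//; last first.
  by move=> i; exact: measurable_shape_event.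
rewrite (shape_null bl) big_ord1 kesten_offspring_word//= kesten_pE.
rewrite (eq_bigr (fun j : 'I_(width s) => alpha (branch s j) / c)); last first.
  by move=> j _; rewrite nth_nseq ltn_ord; exact: IH.
rewrite big_split/= prodr_const card_ord exprVn.
set P := \prod_(i < _) _.
have ck : c ^+ width s / c ^+ width s = 1 by rewrite divff// expf_neq0.
have -> : c ^+ width s / c * p (width s) * (P / c ^+ width s) =
  p (width s) * P / c * (c ^+ width s / c ^+ width s) by lra.
by rewrite ck mulr1.
Qed.

(** Both sides satisfy the same recursion.  The uniform choice of the marked child
    cancels the size bias, and the powers of [c] compensate the conditioning of the
    [k - 1] other subtrees. *)
Lemma marked_tree_shape h (s : tree_shape h) :
  prob (Q true) (forget @^-1` shape_event R s) = spine_weight p nu w D s.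
Proof.
elim: h s => [|h IH] s; first by rewrite /= preimage_setT probT.
rewrite (@prob_forget_node _ _ _ Q QGW mass1)//; last first.
  by move=> i; exact: measurable_shape_event.
rewrite /= !mulr_sumr; apply: eq_bigr => i _.
have /= -> := @kesten_offspring_word R p c true (width s) i (ltn_ord i).
rewrite kesten_p1E (bigD1 i)//=.
rewrite nth_mkseq// eqxx IH.
rewrite (eq_bigr (fun j : 'I_(width s) => alpha (branch s j) / c)); last first.
  move=> j ji; rewrite nth_mkseq// (negbTE (ji : (j : nat) != i)).
  exact: unmarked_tree_shape.
rewrite big_split/= prodr_const cardC1 card_ord exprVn.
set P := \prod_(j < _ | _) _; set K := spine_weight _ _ _ _ _; set k := width s.
have k0 : k%:R != 0 :> R by rewrite pnatr_eq0 -lt0n; exact: leq_ltn_trans (ltn_ord i).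
have ck : c ^+ k.-1 / c ^+ k.-1 = 1 by rewrite divff// expf_neq0.
have -> : p k * (k%:R * c ^+ k.-1) / D / k%:R * (K * (P / c ^+ k.-1)) =
  D^-1 * (p k * (K * P)) * (k%:R / k%:R) * (c ^+ k.-1 / c ^+ k.-1) by lra.
by rewrite ck divff// !mulr1.
Qed.

Lemma marked_tree_finite h : Q true (forget @^-1` finite_below R h) = 1%E.
Proof. exact: spine_tree_finite QGW mass1 true h. Qed.

End kesten_tree.

(** * Independent summands *)

(** By Fubini, conditionally on [Y = z] the comparison is the hypothesis at [y - z],
    which is at most [y] because [Y] is nonnegative. *)
Lemma independent_sum_le (R : realType) d d' (T : measurableType d)
    (S : measurableType d') (P : probability T R) (nu : probability S R)
    (X : {mfun T >-> S}) (Y : {mfun T >-> R}) (w : S -> R) (A : set S)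
    (eta y : R) :
  measurable_fun setT w -> measurable A -> 0 <= eta -> (forall t, 0 <= Y t) ->
  (forall B C, measurable B -> measurable C ->
    P (X @^-1` B `&` Y @^-1` C) = (nu B * P (Y @^-1` C))%E) ->
  (forall z, z <= y ->
    (nu (A `&` [set x | (w x <= z)%R]) <= eta%:E * nu [set x | (w x <= z)%R])%E) ->
  (P [set t | A (X t) /\ (w (X t) + Y t <= y)%R] <=
    eta%:E * P [set t | (w (X t) + Y t <= y)%R])%E.
Proof.
move=> mw mA eta0 Y0 indep Aeta.
have mXY : measurable_fun setT (fun t => (Y t, X t)) by exact: measurable_fun_pair.
pose XY : {mfun T >-> (R * S)%type} :=
  HB.pack (fun t => (Y t, X t)) (isMeasurableFun.Build _ _ _ _ _ mXY).
have joint V : measurable V -> P (XY @^-1` V) = (\int[distribution P Y]_z nu (xsection V z))%E.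
  move=> mV; rewrite -[LHS]/(distribution P XY V).
  rewrite -(@product_measure_unique _ _ _ _ _ (distribution P Y) nu (distribution P XY))//.
  move=> C B mC mB; rewrite muleC -indep//; congr (P _).
  by apply/seteqP; split=> t [].
(* The condition 0 <= z keeps y - z in the range of the hypothesis. *)
pose V B : set (R * S) := [set zx | B zx.2 /\ 0 <= zx.1 /\ w zx.2 + zx.1 <= y].
have mV B : measurable B -> measurable (V B).
  move=> mB; rewrite (_ : V B = (setT `*` B) `&` ((`[0, +oo[%classic `*` setT) `&`
    (fun zx : R * S => w zx.2 + zx.1) @^-1` `]-oo, y]%classic)); last first.
    apply/seteqP; split=> -[z x] /=; rewrite !in_itv/= andbT.
      by move=> [? [? ?]].
    by move=> [[_ ?] [[? _] ?]].
  apply: measurableI; first exact: measurableX.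
  apply: measurableI; first exact: measurableX.
  rewrite -[X in measurable X]setTI.
  apply: (measurable_funD (measurableT_comp mw measurable_snd) measurable_fst) => //.
have secV B z : xsection (V B) z =
    if 0 <= z then B `&` [set x | w x <= y - z] else set0.
  apply/seteqP; split=> x; rewrite /xsection/= ?inE /V/=.
    by move=> [Bx [z0 wx]]; rewrite z0; split=> //=; rewrite lerBrDr.
  by case: ifP => // z0 [Bx]; rewrite /= lerBrDr.
rewrite (_ : [set t | A (X t) /\ _] = XY @^-1` V A); last first.
  apply/seteqP; split=> t; last by move=> [At [_ wt]].
  by move=> [At wt]; split=> //; split=> //; exact: Y0.
rewrite (_ : [set t | w (X t) + Y t <= y] = XY @^-1` V setT); last first.
  apply/seteqP; split=> t; last by move=> [_ [_ wt]].
  by move=> wt; split=> //; split=> //; exact: Y0.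
have mVA := mV _ mA; have mVT := mV _ measurableT.
rewrite !joint// -ge0_integralZl//; last exact: measurable_fun_xsection.
apply: ge0_le_integral => //.
- exact: measurable_fun_xsection.
- by apply: measurable_funeM; exact: measurable_fun_xsection.
- move=> z _; rewrite !secV; case: ifP => z0; last by rewrite !measure0 mule0.
  by rewrite setTI; apply: Aeta; rewrite lerBlDr lerDl.
Qed.

Section branch_independence.
Variables (R : realType) (w : tree_space -> R).
Hypothesis mw : measurable_fun setT w.

(** The events that constrain separately the subtrees of ranks in [s] are stable
    under intersection and generate a sigma-algebra for which the sum is
    measurable. *)
Lemma rectangle_unique (s : seq nat) (M1 M2 : {measure set tree_space -> \bar R})
    (C : set R) : measurable C -> (M1 setT < +oo)%E ->
  (forall A : nat -> set tree_space, (forall i, measurable (A i)) ->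
    M1 [set t | forall i, i \in s -> A i (subtree t i)] =
    M2 [set t | forall i, i \in s -> A i (subtree t i)]) ->
  M1 [set t | C (\sum_(i <- s) w (subtree t i))] =
  M2 [set t | C (\sum_(i <- s) w (subtree t i))].
Proof.
move=> mC M1fin M12.
pose G : set (set tree_space) := [set E | exists2 A : nat -> set tree_space,
  forall i, measurable (A i) & E = [set t | forall i, i \in s -> A i (subtree t i)]].
have GT : G setT by exists (fun=> setT) => //; apply/seteqP; split.
apply: (@g_sigma_algebra_measure_unique _ _ _ G _ (fun=> setT)) => //.
- move=> _ [A mA ->].
  rewrite (_ : [set t | _] = \bigcap_(i in [set i | i \in s])
    ((fun t : tree_space => subtree t i : tree_space) @^-1` A i)); last first.
    by apply/seteqP; split=> t tA i; apply: tA.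
  apply: bigcap_measurableType => i _; rewrite -[X in measurable X]setTI.
  exact: (measurable_subtree i measurableT).
- by apply/seteqP; split=> // t _; exists 0%N.
- move=> _ _ [A mA ->] [B mB ->]; exists (fun i => A i `&` B i).
    by move=> i; exact: measurableI.
  apply/seteqP; split=> t.
    by move=> [tA tB] i si; split; [exact: tA|exact: tB].
  by move=> tAB; split=> i si; have [] := tAB i si.
- by move=> _ [A mA ->]; exact: M12.
have mY : measurable_fun [set: g_sigma_algebraType G]
    (fun t : g_sigma_algebraType G => \sum_(i <- s) w (subtree t i)).
  rewrite (_ : (fun t => _) = (fun t : g_sigma_algebraType G =>
    \sum_(i <- s) if i \in s then w (subtree t i) else 0)); last first.
    by apply/funext => t; apply: eq_big_seq => i ->.
  apply: (@measurable_sum _ (g_sigma_algebraType G) _ _ _ _ (fun i t =>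
    if i \in s then w (subtree t i) else 0)) => i.
  have [si|si] := boolP (i \in s); last exact: measurable_cst.
  apply: (measurableT_comp mw) => _ A mA; rewrite setTI; apply: sub_sigma_algebra.
  exists (fun j => if j == i then A else setT); first by move=> j; case: ifP.
  apply/seteqP; split=> t; last by move=> /(_ i si); rewrite eqxx.
  by move=> tA j _; case: ifPn => // /eqP ->.
by have := mY measurableT _ mC; rewrite setTI.
Qed.

End branch_independence.

(** * The conditioned tree without extinction *)

Section no_extinction.
Variables (R : realType) (p : nat -> R) (m : R).
Variables (nu : probability tree_space R) (w : tree_space -> R).
Hypothesis p_pmf : is_pmf p.
Hypothesis bl : branching_limit p m nu w.
Local Notation pr := (prob nu).
Hypothesis null0 : pr (null w) = 0.
Variable a : nat.
Hypothesis pa_gt0 : 0 < p a.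
Hypothesis pa_min : forall k, (k < a)%N -> p k = 0.

Let m0 := branching_m_gt0 bl.
Let w0 := branching_ge0 bl.
Let mw := branching_measurable bl.
Let msmall := measurable_small bl.

Definition below (y : R) : set tree_space := [set t | w t <= y].

Let mbelow y : measurable (below y).
Proof.
rewrite (_ : below y = w @^-1` `]-oo, y]%classic).
  exact: (measurable_w bl (measurable_itv _)).
by apply/seteqP; split=> t /=; rewrite /below/= in_itv.
Qed.

(** The limit is almost surely positive. *)
Lemma prob_below B y : measurable B -> pr (B `&` below y) = pr (B `&` small w y).
Proof.
move=> mB; congr fine; apply: (@eq_measure_up_to_negligible _ _ _ _ (null w)).
- exact: measurableI.
- exact: measurableI.
- apply/negligibleP; first exact: (measurable_null bl).
  by rewrite -[LHS]/(nu (null w)) -probK ?null0//; exact: (measurable_null bl).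
- move=> t tn; split=> -[tB ty]; split=> //; last by case/andP: ty.
  by apply/andP; split=> //; rewrite lt_def w0 andbT; apply/eqP.
Qed.

Local Notation all_node k := (node_event R k (fun=> setT)).

Let mall k : measurable (all_node k).
Proof. exact: measurable_node_event. Qed.

Local Notation ranks k := (index_iota 1 k.+1).

Let branch_sumE k t : \sum_(i <- ranks k) w (subtree t i) = branch_sum w k t.
Proof. by rewrite /branch_sum big_add1 big_mkord. Qed.

Let msum (s : seq nat) y :
  measurable [set t : tree_space | \sum_(i <- s) w (subtree t i) <= y].
Proof.
have mS : measurable_fun setT (fun t : tree_space => \sum_(i <- s) w (subtree t i)).
  apply: (@measurable_sum _ _ _ _ _ _ (fun i (t : tree_space) => w (subtree t i))) => i.
  exact: (measurableT_comp mw (measurable_subtree i)).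
have := mS measurableT _ (measurable_itv `]-oo, y]).
by rewrite setTI (_ : _ @^-1` _ = [set t | \sum_(i <- s) w (subtree t i) <= y]).
Qed.

Let prob_node_below k A y : (forall i, measurable (A i)) ->
  pr (node_event R k A `&` small w y) =
  pr (node_event R k A `&` [set t | \sum_(i <- ranks k) w (subtree t i) <= m * y]).
Proof.
move=> mA; rewrite -prob_below; last exact: measurable_node_event.
rewrite (_ : below y = w @^-1` `]-oo, y]%classic); last first.
  by apply/seteqP; split=> t /=; rewrite /below/= in_itv.
rewrite (prob_node_limit bl)//; congr (pr (_ `&` _)).
apply/seteqP; split=> t /=; rewrite in_itv/= branch_sumE.
  by rewrite ler_pdivrMl.
by rewrite ler_pdivrMl.
Qed.

(** A sum of [k] terms at most [m * y] has its first [a] terms of sum at most [m * y]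
    and its term of rank [a.+1] at most [m * y] as well, independently of each
    other. *)
Lemma extra_child_le k y : (a < k)%N ->
  p a * pr (all_node k `&` small w y) <=
  p k * pr (small w (m * y)) * pr (all_node a `&` small w y).
Proof.
move=> ak; set z := m * y; rewrite !prob_node_below// -/z.
pose S := [set t : tree_space | \sum_(i <- ranks a) w (subtree t i) <= z].
have mS : measurable S by exact: msum.
pose A1 j : set tree_space := if j == a.+1 then below z else setT.
have mA1 j : measurable (A1 j) by rewrite /A1; case: ifP.
have pa0 : 0 <= p a by exact: ltW.
have pkz0 : 0 <= p k * pr (below z) by rewrite mulr_ge0 ?p_pmf.1 ?prob_ge0.
pose M1 := mscale (NngNum pa0) (mrestr nu (measurable_node_event R k mA1)).
pose M2 := mscale (NngNum pkz0) (mrestr nu (mall a)).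
have M1fin : (M1 setT < +oo)%E.
  rewrite /M1 /mscale/= /mrestr setTI lte_mul_pinfty ?lee_fin//.
  by rewrite (le_lt_trans (probability_le1 nu _)) ?ltry//; exact: measurable_node_event.
have M12 : M1 S = M2 S.
  pose C := `]-oo, z]%classic : set R.
  have SE : S = [set t | C (\sum_(i <- ranks a) w (subtree t i))].
    by apply/seteqP; split=> t /=; rewrite /S/= /C/= in_itv.
  rewrite SE; apply: (rectangle_unique mw) => //; first exact: measurable_itv.
  move=> A mA.
  pose rect := [set t : tree_space | forall i, i \in ranks a -> A i (subtree t i)].
  rewrite -[LHS]/((p a)%:E * nu (rect `&` node_event R k A1))%E.
  rewrite -[RHS]/((p k * pr (below z))%:E * nu (rect `&` all_node a))%E.
  pose B1 j := if j \in ranks a then A j else A1 j.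
  pose B2 j := if j \in ranks a then A j else setT.
  have mB1 j : measurable (B1 j) by rewrite /B1; case: ifP.
  have mB2 j : measurable (B2 j) by rewrite /B2; case: ifP.
  have -> : rect `&` node_event R k A1
      = node_event R k B1.
    apply/seteqP; split=> t.
      move=> [tA [tk t1]]; split=> // i ik; rewrite /B1.
      by case: ifPn => [/tA//|_]; exact: t1.
    move=> [tk tB]; split.
      move=> i; rewrite mem_index_iota => ia; have := tB i; rewrite /B1 mem_index_iota ia.
      by apply; case/andP: ia => -> /= ia; rewrite -ltnS (leq_trans ia)// ltnS ltnW.
    split=> // i ik; have := tB i ik; rewrite /B1 /A1; case: ifPn => //.
    rewrite mem_index_iota => /andP[_ ia]; case: eqP => // ie.
    by rewrite ie ltnn in ia.
  have -> : rect `&` all_node a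
      = node_event R a B2.
    apply/seteqP; split=> t.
      by move=> [tA [tk _]]; split=> // i ik; rewrite /B2; case: ifPn => [/tA|].
    move=> [tk tB]; split=> // i; rewrite mem_index_iota ltnS => ia.
    by have := tB i ia; rewrite /B2 mem_index_iota ltnS ia.
  rewrite !(branching_node bl)// EFinM probK//.
  rewrite (@big_cat_nat _ _ _ a.+1)//=; last by rewrite ltnS ltnW.
  have same B : (forall j, j \in ranks a -> B j = A j) ->
      (\prod_(1 <= j < a.+1) nu (B j) = \prod_(1 <= j < a.+1) nu (A j))%E.
    by move=> BA; apply: eq_big_seq => j ja; rewrite BA.
  rewrite !same; last 2 first.
  - by move=> j ja; rewrite /B2 ja.
  - by move=> j ja; rewrite /B1 ja.
  rewrite big_ltn; last by rewrite ltnS.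
  have -> : B1 a.+1 = below z by rewrite /B1 mem_index_iota ltnn andbF /A1 eqxx.
  have -> : (\prod_(a.+2 <= j < k.+1) nu (B1 j) = 1)%E.
    rewrite big_nat_cond big1// => j; rewrite andbT => /andP[aj _].
    have -> : B1 j = setT.
      by rewrite /B1 mem_index_iota [(j < _)%N]ltnNge (ltnW aj) andbF /A1 gtn_eqF.
    by rewrite probability_setT.
  rewrite mule1 muleCA -[RHS]muleA; congr (_ * _)%E.
  by rewrite [RHS]muleCA; congr (_ * _)%E; exact: muleC.
have mM k' A' : (forall j, measurable (A' j)) -> measurable (S `&` node_event R k' A').
  by move=> mA'; apply: measurableI => //; exact: measurable_node_event.
have prS : p a * pr (S `&` node_event R k A1) = p k * pr (below z) * pr (S `&` all_node a).
  have mSk : measurable (S `&` node_event R k A1) by exact: mM.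
  have mSa : measurable (S `&` all_node a) by exact: mM.
  by apply: EFin_inj; rewrite EFinM (probK nu mSk) [RHS]EFinM (probK nu mSa).
have -> : pr (small w z) = pr (below z) by rewrite -[below z]setTI prob_below// setTI.
rewrite [all_node a `&` _]setIC -prS ler_pM2l//.
apply: prob_mono; [|exact: mM|].
  by apply: measurableI; [exact: mall|exact: msum].
move=> t [[tk _] /= tz].
have tsum i j : (0 < i)%N -> (i <= j.+1)%N -> (j <= k)%N ->
    \sum_(l <- index_iota i j.+1) w (subtree t l) <= z.
  move=> i0 ij jk; apply: le_trans tz.
  rewrite (@big_cat_nat _ _ _ i 1 k.+1)//=; last by rewrite (leq_trans ij).
  rewrite (@big_cat_nat _ _ _ j.+1 i k.+1)//=.
  by rewrite addrCA lerDl addr_ge0// sumr_ge0.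
split; first by apply: tsum => //; exact: ltnW.
split=> // i ik; rewrite /A1; case: ifPn => // /eqP ->.
by have := tsum a.+1 a.+1 isT (leqnSn _) ak; rewrite /index_iota subSnn /= big_seq1.
Qed.

(** Given the number of children, the subtree of rank [i.+1] is independent of the
    sum over the other subtrees, and [independent_sum_le] applies. *)
Lemma rare_child_le i A eta y : (i < a)%N -> measurable A -> 0 <= eta ->
  (forall z, z <= m * y -> pr (A `&` below z) <= eta * pr (below z)) ->
  pr (node_event R a (fun j => if j == i.+1 then A else setT) `&` small w y) <=
  eta * pr (all_node a `&` small w y).
Proof.
move=> ia mA eta0 Aeta.
have mchild (B : set tree_space) : measurable B ->
    forall j : nat, measurable (if j == i.+1 then B else setT : set tree_space).
  by move=> mB j; case: ifP.
pose child (B : set tree_space) := node_event R a (fun j => if j == i.+1 then B else setT).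
have mchildE (B : set tree_space) : measurable B -> measurable (child B).
  by move=> mB; apply: measurable_node_event; exact: mchild.
have childE (B : set tree_space) : child B = all_node a `&` [set t | B (subtree t i.+1)].
  apply/seteqP; split=> t.
    by move=> [tk tB]; split=> //; have := tB i.+1 ia; rewrite eqxx.
  by move=> [[tk _] tB]; split=> // j ja; case: ifPn => // /eqP ->.
rewrite !prob_node_below//; last exact: mchild.
set z := m * y; pose s := rem i.+1 (ranks a).
have ira : i.+1 \in ranks a by rewrite mem_index_iota ltnS.
have uranks : uniq (ranks a) by exact: iota_uniq.
have sE j : (j \in s) = (j != i.+1) && (1 <= j <= a)%N.
  by rewrite /s mem_rem_uniq// inE mem_index_iota ltnS.
have sumE t : \sum_(j <- ranks a) w (subtree t j) =
    w (subtree t i.+1) + \sum_(j <- s) w (subtree t j).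
  by rewrite (big_rem i.+1).
have inv0 : 0 <= (p a)^-1 by rewrite invr_ge0 ltW.
(* The law of the tree given that the root has a children. *)
pose cond := mscale (NngNum inv0) (mrestr nu (mall a)).
have condE E : measurable E -> cond E = ((p a)^-1 * pr (E `&` all_node a))%:E.
  move=> mE; have mEa : measurable (E `&` all_node a) by apply: measurableI.
  by rewrite EFinM (probK nu mEa).
have prall : pr (all_node a) = p a.
  by rewrite (prob_node bl)// big1 ?mulr1// => j _; rewrite probT.
have cond1 : cond setT = 1%E by rewrite condE// setTI prall mulVf// gt_eqF.
pose condm : {measure set tree_space -> \bar R} := cond.
pose P : probability tree_space R :=
  HB.pack_for (probability tree_space R) (Measure.sort condm)
    (Measure_isProbability.Build _ _ _ condm cond1).
have mX : measurable_fun setT (fun t : tree_space => subtree t i.+1 : tree_space).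
  exact: measurable_subtree.
have mY : measurable_fun setT (fun t : tree_space => \sum_(j <- s) w (subtree t j)).
  apply: (@measurable_sum _ _ _ _ _ _ (fun j (t : tree_space) => w (subtree t j))) => j.
  exact: (measurableT_comp mw (measurable_subtree j)).
pose X : {mfun tree_space >-> tree_space} :=
  HB.pack (fun t : tree_space => subtree t i.+1 : tree_space)
    (isMeasurableFun.Build _ _ _ _ _ mX).
pose Y : {mfun tree_space >-> R} :=
  HB.pack (fun t : tree_space => \sum_(j <- s) w (subtree t j))
    (isMeasurableFun.Build _ _ _ _ _ mY).
have mXB B : measurable B -> measurable (X @^-1` B).
  by move=> mB; rewrite -[X in measurable X]setTI; exact: (mX measurableT).
have mYC C : measurable C -> measurable (Y @^-1` C).
  by move=> mC; rewrite -[X in measurable X]setTI; exact: (mY measurableT).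
have indep B C : measurable B -> measurable C ->
    P (X @^-1` B `&` Y @^-1` C) = (nu B * P (Y @^-1` C))%E.
  move=> mB mC; rewrite -[LHS]/(cond _) -[X in (_ * X)%E]/(cond _).
  rewrite !condE//; [|exact: mYC|by apply: measurableI; [exact: mXB|exact: mYC]].
  rewrite -probK// -EFinM mulrCA; congr ((_ * _)%:E).
  pose M1 := mrestr nu (mchildE B mB).
  pose M2 := mscale (NngNum (prob_ge0 nu B)) (mrestr nu (mall a)).
  have M1fin : (M1 setT < +oo)%E.
    rewrite /M1 /mrestr setTI (le_lt_trans (probability_le1 nu _)) ?ltry//.
    exact: (mchildE B mB).
  have M12 : M1 (Y @^-1` C) = M2 (Y @^-1` C).
    apply: (rectangle_unique mw) => // A' mA'.
    pose rect := [set t : tree_space | forall j, j \in s -> A' j (subtree t j)].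
    rewrite -[LHS]/(nu (rect `&` child B)).
    rewrite -[RHS]/((pr B)%:E * nu (rect `&` all_node a))%E.
    pose B1 j := if j \in s then A' j else if j == i.+1 then B else setT.
    pose B2 j := if j \in s then A' j else setT.
    have mB1 j : measurable (B1 j) by rewrite /B1; case: ifP => // _; exact: mchild.
    have mB2 j : measurable (B2 j) by rewrite /B2; case: ifP.
    have -> : rect `&` child B = node_event R a B1.
      apply/seteqP; split=> t.
        move=> [tA [tk tB]]; split=> // j ja; rewrite /B1.
        by case: ifPn => [/tA//|_]; exact: tB.
      move=> [tk tB]; split=> [j js|]; last split=> // j ja.
        by have := js; rewrite sE => /andP[_ ja]; have := tB j ja; rewrite /B1 js.
      by case: ifPn => // /eqP ji; have := tB j ja; rewrite /B1 sE ji eqxx.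
    have -> : rect `&` all_node a = node_event R a B2.
      apply/seteqP; split=> t.
        by move=> [tA [tk _]]; split=> // j ja; rewrite /B2; case: ifPn => [/tA|].
      move=> [tk tB]; split=> // j js.
      by have := js; rewrite sE => /andP[_ ja]; have := tB j ja; rewrite /B2 js.
    rewrite !(branching_node bl)// !(big_rem i.+1 ira)/= probK//.
    have -> : B1 i.+1 = B by rewrite /B1 sE eqxx.
    have -> : B2 i.+1 = setT by rewrite /B2 sE eqxx.
    rewrite probability_setT mul1e [RHS]muleCA; congr (_ * (_ * _))%E.
    by apply: eq_big_seq => j js; rewrite /B1 /B2 -/s js.
  have -> : X @^-1` B `&` Y @^-1` C `&` all_node a = Y @^-1` C `&` child B.
    by rewrite childE setIC setIA [_ `&` X @^-1` B]setIC setIC [X @^-1` B `&` _]setIC.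
  have mYa : measurable (Y @^-1` C `&` all_node a).
    by apply: measurableI; [exact: mYC|exact: mall].
  have mYB : measurable (Y @^-1` C `&` child B).
    by apply: measurableI; [exact: mYC|exact: (mchildE B mB)].
  by apply: EFin_inj; rewrite EFinM (probK nu mYa) (probK nu mYB); exact: M12.
have Y0 t : 0 <= Y t by exact: sumr_ge0.
have Aeta' x : x <= z ->
    (nu (A `&` [set t | (w t <= x)%R]) <= eta%:E * nu [set t | (w t <= x)%R])%E.
  move=> /Aeta; rewrite -lee_fin EFinM !probK//.
  exact: measurableI.
have := independent_sum_le mw mA eta0 Y0 indep Aeta'.
have mSz : measurable [set t : tree_space | \sum_(j <- ranks a) w (subtree t j) <= z].
  exact: msum.
rewrite -[X in (X <= _)%E]/(cond _) -[X in (_ <= _ * X)%E]/(cond _).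
rewrite (_ : [set t | w (X t) + Y t <= z] =
  [set t : tree_space | \sum_(j <- ranks a) w (subtree t j) <= z]); last first.
  by apply/seteqP; split=> t /=; rewrite sumE.
rewrite (_ : [set t | A (X t) /\ _] = X @^-1` A `&`
  [set t : tree_space | \sum_(j <- ranks a) w (subtree t j) <= z]); last first.
  by apply/seteqP; split=> t /=; rewrite sumE.
rewrite !condE//; last by apply: measurableI => //; exact: mXB.
rewrite -EFinM lee_fin mulrCA ler_pM2l ?invr_gt0//.
rewrite [_ `&` all_node a]setIC setIA -/(child A) childE.
by rewrite [X in eta * pr X]setIC.
Qed.

Let irregular h : set tree_space := ~` shape_event R (regular_shape a h).

Let mirregular h : measurable (irregular h).
Proof. by apply: measurableC; exact: measurable_shape_event. Qed.

Let other_degree_le y : pr (~` all_node a `&` small w y) <=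
  pr (small w (m * y)) / p a * pr (small w y).
Proof.
have mB : measurable (~` all_node a `&` small w y).
  by apply: measurableI => //; apply: measurableC.
set L := _ / p a * _; have L0 : 0 <= L by rewrite mulr_ge0 ?divr_ge0 ?prob_ge0// ltW.
have cL : series (fun k => p k * L) @ \oo --> L.
  have : series p n * L @[n --> \oo] --> 1 * L by apply: cvgMl; exact: pmf_series.
  rewrite mul1r; apply: cvg_trans; apply: near_eq_cvg; apply: nearW => n.
  by rewrite /series/= mulr_suml.
have cB := prob_by_degree p_pmf bl mB.
rewrite -(cvg_lim _ cB)// -[leRHS](cvg_lim _ cL)//; apply: lim_series_le.
- by apply/cvg_ex; eexists; exact: cB.
- by apply/cvg_ex; eexists; exact: cL.
move=> k; have [ka|ak|->] := ltngtP k a.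
- rewrite (pa_min ka) mul0r; have <- : pr (all_node k) = 0.
    by rewrite (prob_node bl)// pa_min// mul0r.
  by apply: prob_mono => //; exact: measurableI.
- apply: (@le_trans _ _ (pr (all_node k `&` small w y))).
    apply: prob_mono; [exact: measurableI|exact: measurableI|].
    by move=> t [tk [_ ty]].
  rewrite /L mulrA mulrA mulrAC ler_pdivlMr// mulrC.
  apply: le_trans (extra_child_le y ak) _.
  rewrite -!mulrA ler_wpM2l ?p_pmf.1// ler_wpM2l ?prob_ge0//.
  by apply: prob_mono => //; exact: measurableI.
- have -> : all_node a `&` (~` all_node a `&` small w y) = set0.
    by apply/seteqP; split=> // t [ta [nta _]].
  by rewrite prob0 mulr_ge0 ?p_pmf.1.
Qed.

(** The bound has to hold for all [y <= x], because the induction step compares at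
    all levels below [m * y]. *)
Let irregular_le h : exists eta : R -> R, [/\ eta x @[x --> 0^'+] --> (0 : R),
  forall x, 0 <= eta x &
  forall x y, y <= x -> pr (irregular h `&` small w y) <= eta x * pr (small w y)].
Proof.
elim: h => [|h [eta [eta_cvg eta_ge0 etaP]]].
  exists (fun=> 0); split=> [||x y _]; [exact: cvg_cst|by []|].
  by rewrite /irregular/= setCT set0I prob0 mul0r.
exists (fun x => pr (small w (m * x)) / p a + a%:R * eta (m * x)); split.
- have h1 : pr (small w (m * x)) / p a @[x --> 0^'+] --> 0 / p a.
    by apply: cvgMl; exact: (cvg_at_right0_scale m0 (small_cvg0 bl)).
  have h2 : a%:R * eta (m * x) @[x --> 0^'+] --> (a%:R * 0 : R).
    by apply: cvgMr; exact: (cvg_at_right0_scale m0 eta_cvg).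
  have E0 : 0 / p a + a%:R * 0 = 0 :> R by rewrite mul0r mulr0 addr0.
  by rewrite -[X in _ --> X]E0; exact: cvgD.
- move=> x; apply: addr_ge0; last by rewrite mulr_ge0.
  by rewrite divr_ge0 ?prob_ge0// ltW.
move=> x y yx; have mxy : m * y <= m * x by rewrite ler_pM2l.
pose child i := node_event R a (fun j => if j == i.+1 then irregular h else setT)
  `&` small w y.
have mchild i : measurable (child i).
  apply: measurableI => //; apply: measurable_node_event => j.
  by case: ifP => // _; exact: mirregular.
have child_le i : (i < a)%N -> pr (child i) <= eta (m * x) * pr (small w y).
  move=> ia; have h1 z : z <= m * y ->
      pr (irregular h `&` below z) <= eta (m * x) * pr (below z).
    move=> zy; rewrite prob_below; last exact: mirregular.
    rewrite -[below z]setTI prob_below// setTI.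
    by apply: etaP; exact: le_trans zy mxy.
  apply: le_trans (rare_child_le ia (mirregular h) (eta_ge0 _) h1) _.
  apply: ler_wpM2l => //; apply: prob_mono => //; exact: measurableI.
have mU : measurable (\big[setU/set0]_(i < a) child i) by exact: bigsetU_measurable.
have mO : measurable (~` all_node a `&` small w y).
  by apply: measurableI => //; apply: measurableC.
apply: (@le_trans _ _ (pr ((~` all_node a `&` small w y) `|`
    \big[setU/set0]_(i < a) child i))).
  apply: prob_mono.
  - by apply: measurableI => //; exact: mirregular.
  - exact: measurableU.
  move=> t [irr ty]; have [ta|nta] := pselect (all_node a t); last by left; split.
  right; rewrite -bigcup_mkord; apply: contrapT => nchild; apply: irr.
  split; first by case: ta; rewrite /width/= size_nseq.
  rewrite /width/= size_nseq => -[|i]// ia; rewrite /branch/= nth_nseq (ia : (i < a)%N).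
  apply: contrapT => ti; apply: nchild; exists i => //=; split=> //.
  case: ta => tk _; split=> // j _; by case: ifPn => // /eqP ->.
apply: le_trans (probU_le nu mO mU) _; rewrite mulrDl; apply: lerD.
  apply: le_trans (other_degree_le y) _; apply: ler_wpM2r; first exact: prob_ge0.
  rewrite ler_pM2r ?invr_gt0//; apply: prob_mono => //; exact: small_le.
apply: le_trans (prob_bigU_le nu a mchild) _.
apply: (@le_trans _ _ (\sum_(i < a) eta (m * x) * pr (small w y))).
  by apply: ler_sum => i _; exact: child_le.
by rewrite sumr_const card_ord -[leLHS]mulr_natl mulrA.
Qed.

Hypothesis small_gt0 : forall x, 0 < x -> 0 < pr (small w x).

Lemma regular_small_limit h :
  pr (shape_event R (regular_shape a h) `&` small w x) / pr (small w x)
    @[x --> 0^'+] --> (1 : R).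
Proof.
have [eta [eta_cvg eta_ge0 etaP]] := irregular_le h.
have lower : 1 - eta x @[x --> 0^'+] --> (1 : R).
  by rewrite -[X in _ --> X]subr0; apply: cvgB => //; exact: cvg_cst.
have upper : (fun=> 1 : R) @ (0 : R)^'+ --> (1 : R) by exact: cvg_cst.
apply: (squeeze_cvgr _ lower upper); near=> x.
have x0 : 0 < pr (small w x) by apply: small_gt0; near: x; exact: nbhs_right_gt.
have mS := measurable_shape_event R (regular_shape a h).
rewrite ler_pdivlMr// ler_pdivrMr// mul1r; apply/andP; split; last first.
  by apply: prob_mono => //; exact: measurableI.
have h1 := etaP x x (lexx x).
have h2 : pr (small w x) <= pr (shape_event R (regular_shape a h) `&` small w x) +
    pr (irregular h `&` small w x).
  apply: (@le_trans _ _ (pr ((shape_event R (regular_shape a h) `&` small w x) `|`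
      (irregular h `&` small w x)))); last first.
    by apply: probU_le; apply: measurableI => //; exact: mirregular.
  apply: prob_mono => //.
    by apply: measurableU; apply: measurableI => //; exact: mirregular.
  by rewrite -setIUl setUv setTI.
by rewrite mulrBl mul1r; lra.
Unshelve. all: by end_near. Qed.

End no_extinction.

(** * Conclusion *)

Lemma support_inf_min (R : realType) (p : nat -> R) (a : nat) : 0 < p a ->
  (forall k, 0 < p k -> (a <= k)%N) -> support_inf p = a%:R%:E.
Proof.
move=> pa amin; apply/eqP; rewrite eq_le; apply/andP; split.
  by apply: ereal_inf_lbound; exists a.
by apply: le_ereal_inf_tmp => _ [k /= pk <-]; rewrite lee_fin ler_nat amin.
Qed.

Section conditioning.
Variables (R : realType) (p : nat -> R) (m c : R).
Variables (nu : probability tree_space R) (w : tree_space -> R).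
Hypothesis p_pmf : is_pmf p.
Hypothesis p_mean : (1 < mean p < +oo)%E.
Hypothesis c_ext : is_extinction_prob p c.
Hypothesis bl : branching_limit p m nu w.
Local Notation pr := (prob nu).
Hypothesis small_gt0 : forall x, 0 < x -> 0 < pr (small w x).

(** A fixed point of the generating function which is not one. *)
Lemma null_extinction : pr (null w) = c.
Proof.
have [c0 c1 fc] := c_ext.
have mn := measurable_null bl; have ms := measurable_small bl 1.
have q1 : pr (null w) < 1.
  apply: (@le_lt_trans _ _ (pr (~` small w 1))).
    apply: prob_mono => //; first exact: measurableC.
    by move=> t /= t0; rewrite /small/= t0 ltxx.
  rewrite /prob probability_setC// fineB ?fin_num_measure//.
  by rewrite ltrBlDr ltrDl; exact: small_gt0.
apply: (genfun_fixpoint_unique p_pmf p_mean) => //; first by rewrite prob_ge0.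
- by rewrite c0.
- exact: genfun_null p_pmf bl.
Qed.

Let tau0_regular d0 (Om0 : measurableType d0) (P0 : probability Om0 R)
    (T0 : Om0 -> tree_space) (A : set tree_space) : is_tau0 p c P0 T0 -> c = 0 ->
  measurable A -> A (regular_tree (support_inf p)) -> P0 (T0 @^-1` A) = 1%E.
Proof.
move=> [[mT0 _] T0reg _] c0 mA Areg; have {T0reg}reg := T0reg c0.
rewrite -(probability_setT P0); apply: (eq_measure_up_to_negligible _ _ reg) => //.
  by rewrite -[X in measurable X]setTI; exact: (mT0 measurableT).
by move=> o /contrapT /= To; split=> // _; rewrite To.
Qed.

Let minimal_degree : c = 0 -> exists a, [/\ 0 < p a,
  forall k, (k < a)%N -> p k = 0 & support_inf p = a%:R%:E].
Proof.
move=> _; have [k k1 pk] := branching_charge p_pmf p_mean.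
have exp : exists k, 0 < p k by exists k.
case: (ex_minnP exp) => a pa amin; exists a; split=> //; last exact: support_inf_min.
move=> k' k'a; apply/eqP; rewrite eq_le p_pmf.1 andbT leNgt; apply/negP => /amin.
by rewrite leqNgt k'a.
Qed.

(** The limiting probabilities of the shapes are those of [tau0]: the spine of
    the Kesten tree is the line of descent that carries the positive mass, and
    without extinction every vertex has as few children as possible. *)
Lemma shape_tau0_limit d0 (Om0 : measurableType d0) (P0 : probability Om0 R)
    (T0 : Om0 -> tree_space) h (s : tree_shape h) : is_tau0 p c P0 T0 ->
  pr (shape_event R s `&` small w x) / pr (small w x) @[x --> 0^'+] -->
    prob P0 (T0 @^-1` shape_event R s).
Proof.
move=> T0tau0; have [c0 c1 fc] := c_ext; have nullc := null_extinction.
move: c0; rewrite le_eqVlt => /predU1P[c0|c0]; last first.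
  have c01 : 0 < c < 1 by rewrite c0.
  have [_ _ /(_ c0)[Q [QGW Q0]]] := T0tau0.
  have /andP[mean1 mean_fin] := p_mean.
  have -> : prob P0 (T0 @^-1` shape_event R s) =
      prob (Q true) (@forget_types bool @^-1` shape_event R s).
    by rewrite /prob Q0//; exact: measurable_shape_event.
  rewrite (marked_tree_shape p_pmf p_mean bl c01 fc nullc QGW).
  apply: (shape_small_limit p_pmf bl small_gt0).
    by rewrite gt_eqF//; exact: (spine_mean_gt0 p_pmf p_mean c01).
  by have := small_ratio p_pmf bl small_gt0 mean_fin mean1; rewrite nullc.
have null0 : pr (null w) = 0 by rewrite nullc.
have [a [pa pa_min infE]] := minimal_degree (esym c0).
have mS h' (s' : tree_shape h') := measurable_shape_event R s'.
have reg := tau0_regular T0tau0 (esym c0) (mS h (regular_shape a h)).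
rewrite infE in reg; have {}reg := reg (regular_shape_event R a h).
have cvg_reg := regular_small_limit p_pmf bl null0 pa pa_min small_gt0 h.
have [->|sreg] := eqVneq s (regular_shape a h); first by rewrite /prob reg.
have mT0S h' (s' : tree_shape h') : measurable (T0 @^-1` shape_event R s').
  by case: T0tau0 => -[mT0 _] _ _; rewrite -[X in measurable X]setTI; exact: (mT0 measurableT).
have disj t : shape_event R s t -> shape_event R (regular_shape a h) t -> False.
  by move=> ts /(shape_event_inj ts) sE; rewrite sE eqxx in sreg.
have -> : prob P0 (T0 @^-1` shape_event R s) = 0.
  apply/eqP; rewrite eq_le prob_ge0 andbT.
  apply: (@le_trans _ _ (prob P0 (~` (T0 @^-1` shape_event R (regular_shape a h))))).
    apply: prob_mono => //; first exact: measurableC.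
    by move=> o os oreg; exact: disj os oreg.
  by rewrite /prob probability_setC// reg subee.
have upper : 1 - pr (shape_event R (regular_shape a h) `&` small w x) / pr (small w x)
    @[x --> 0^'+] --> (0 : R).
  by rewrite -[X in _ --> X](subrr (1 : R)); apply: cvgB => //; exact: cvg_cst.
have lower : (fun=> 0 : R) @ (0 : R)^'+ --> (0 : R) by exact: cvg_cst.
apply: (squeeze_cvgr _ lower upper); near=> x.
have x0 : 0 < pr (small w x) by apply: small_gt0; near: x; exact: nbhs_right_gt.
rewrite divr_ge0 ?prob_ge0//= lerBrDr -mulrDl ler_pdivrMr// mul1r.
have ms := measurable_small bl x.
pose E (i : nat) := (if i == 0%N then shape_event R s else
  shape_event R (regular_shape a h)) `&` small w x.
have mE i : measurable (E i) by rewrite /E; case: ifP => _; exact: measurableI.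
have <- : pr (\big[setU/set0]_(i < 2) E i) = pr (shape_event R s `&` small w x) +
    pr (shape_event R (regular_shape a h) `&` small w x).
  rewrite prob_bigU//; first by rewrite !big_ord_recl big_ord0 addr0.
  move=> [|[|i]] [|[|j]]//= t [ts _] [tr _] _ _; first by case: (disj t).
  by case: (disj t).
apply: prob_mono => //; first exact: bigsetU_measurable.
by rewrite -bigcup_mkord => t [i _ []].
Unshelve. all: by end_near. Qed.

Lemma tau0_finite d0 (Om0 : measurableType d0) (P0 : probability Om0 R)
    (T0 : Om0 -> tree_space) h : is_tau0 p c P0 T0 ->
  P0 (T0 @^-1` finite_below R h) = 1%E.
Proof.
move=> T0tau0; have [c0 c1 fc] := c_ext.
have mF := measurable_finite_below R h.
move: c0; rewrite le_eqVlt => /predU1P[c0|c0]; last first.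
  have c01 : 0 < c < 1 by rewrite c0.
  have [_ _ /(_ c0)[Q [QGW Q0]]] := T0tau0; rewrite Q0//.
  exact: (marked_tree_finite p_pmf p_mean c01 fc QGW).
have [a [_ _ infE]] := minimal_degree (esym c0).
apply: (tau0_regular T0tau0 (esym c0) mF); rewrite infE.
by exists (regular_shape a h); exact: regular_shape_event.
Qed.

End conditioning.

Theorem corollary7p2 (R : realType) (p : nat -> R)
    (p_pmf : is_pmf p)
    (p_nondegenerate : (support_inf p < support_sup p)%E)
    (p_supercritical : (1 < mean p)%E)
    (p_finite_mean : (mean p < +oo)%E)
    (c : R) (c_ext : is_extinction_prob p c)
    (r : nat -> R) (r_norming : seneta_heyde p c r)
    (d : measure_display) (Om : measurableType d) (P : probability Om R)
    (tau : Om -> tree_space) (tau_GW : is_GW p P tau)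
    (W : Om -> R) (W_lim : is_norming_limit r P tau W)
    (d1 : measure_display) (Om1 : R -> measurableType d1)
    (P1 : forall eps : R, probability (Om1 eps) R)
    (tau1 : forall eps : R, Om1 eps -> tree_space)
    (tau1_tree : forall eps, 0 < eps < 1 -> random_tree (tau1 eps))
    (tau1_law : forall eps, 0 < eps < 1 ->
       distributed_conditionally P tau [set o | 0 < W o <= eps]
         (P1 eps) (tau1 eps))
    (d0 : measure_display) (Om0 : measurableType d0) (P0 : probability Om0 R)
    (tau0 : Om0 -> tree_space) (tau0_law : is_tau0 p c P0 tau0) :
  local_cvg_distr 0^'+ P1 tau1 P0 tau0.
Proof.
have p_mean : (1 < mean p < +oo)%E by rewrite p_supercritical.
have r_gt0 : forall n, 0 < r n by case: r_norming.
have [m m0 r_ratio] := norming_ratio p_pmf p_mean c_ext r_norming.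
have [nu bl nuAB] := GW_branching_limit tau_GW W_lim r_gt0 m0 r_ratio.
set w := limit_size r in bl nuAB.
have ms := measurable_small bl.
have smallE A x : measurable A ->
    P (tau @^-1` A `&` [set o | 0 < W o <= x]) = nu (A `&` small w x).
  move=> mA; have := nuAB A `]0, x]%classic mA (measurable_itv _).
  rewrite (_ : W @^-1` _ = [set o | 0 < W o <= x]); last first.
    by apply/seteqP; split=> o /=; rewrite in_itv.
  have -> : limit_size r @^-1` `]0, x]%classic = small w x.
    by apply/seteqP; split=> t /=; rewrite /small/= in_itv.
  exact.
have smallTE x : P [set o | 0 < W o <= x] = nu (small w x).
  by have := smallE setT x measurableT; rewrite preimage_setT !setTI.
(* Conditioning on a null event would not give a probability. *)
have small_gt0 x : 0 < x -> 0 < prob nu (small w x).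
  move=> x0; pose y := Num.min x (1 / 2).
  have [y0 yx y1] : [/\ 0 < y, y <= x & y < 1].
    rewrite /y lt_min x0 ge_min lexx gt_min; split=> //; first lra.
    by apply/orP; right; lra.
  apply: (@lt_le_trans _ _ (prob nu (small w y))); last first.
    by apply: prob_mono => //; exact: small_le.
  have y01 : 0 < y < 1 by rewrite y0.
  rewrite lt_def prob_ge0 andbT; apply/eqP => yE.
  have := tau1_law y y01 setT measurableT.
  rewrite preimage_setT probability_setT smallTE -/(prob nu _) yE invr0 mule0 => /eqP.
  by rewrite eqe oner_eq0.
have near01 : \forall eps \near (0 : R)^'+, 0 < eps < 1.
  near=> eps; apply/andP; split; first by near: eps; exact: nbhs_right_gt.
  by near: eps; apply: nbhs_right_lt.
apply: local_cvg_from_shapes.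
- by apply: filterS near01 => eps; exact: tau1_tree.
- by case: tau0_law.
- move=> h s.
  have := shape_tau0_limit p_pmf p_mean c_ext bl small_gt0 (s := s) tau0_law.
  apply: cvg_trans; apply: near_eq_cvg; apply: filterS near01 => eps eps01.
  have mS := measurable_shape_event R s.
  rewrite (tau1_law eps eps01 _ mS) smallE// smallTE -/(prob nu (small w eps)).
  by rewrite -probK ?fineM//; exact: measurableI.
- by move=> h; exact: (tau0_finite p_pmf p_mean c_ext h tau0_law).
Unshelve. all: by end_near. Qed.
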